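(* Let $n \geq 7$ be an integer and let $S = \{\pm a, \pm b, \pm c\} \subset \mathbb{Z}_n$ be such that $|S| = 6$ and $\langle S \rangle = \mathbb{Z}_n$. Suppose that the circulant $\Gamma = \mathrm{Circ}(n; S)$ is distance magic and that there exists at least one $j \in \mathcal{A}_n(S)$ of type 3. Then all of the following hold: - $n$ is divisible by $60$, the $3$-part of $n$ is $3$ and the $5$-part of $n$ is $5$; - there is a unique $s \in S$ with $5 \mid s$ and $s < n/2$, and this $s$ is one of $n/12$ and $5n/12$; - there exists at least one $j \in \mathcal{A}_n(S)$ of type 1, and there are no $j \in \mathcal{A}_n(S)$ of type 2; - all $j \in \mathcal{A}_n(S)$ of type 1 are odd and are divisible by $15$, while all $j \in \mathcal{A}_n(S)$ of type 3 are even and coprime to $15$.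
   Context: $\mathbb{Z}_n$ is the ring of residue classes modulo $n$ (and its additive cyclic group); $\langle S\rangle$ is the additive subgroup generated by $S$. When elements of $S$ are compared or tested for divisibility they are identified with their representatives in $\{0,1,\dots,n-1\}$. For a prime $p$ and an integer $m$, the $p$-part of $m$ is $p^t$ where $t$ is the largest integer with $p^t \mid m$. For $S \subset \mathbb{Z}_n$ with $S=-S$ and $0 \notin S$, the circulant $\mathrm{Circ}(n;S)$ is the graph with vertex set $\mathbb{Z}_n$ in which $i,j$ are adjacent iff $j-i \in S$. A graph $\Gamma=(V,E)$ of order $n$ is distance magic if there are a bijection $\ell\colon V \to \{1,\dots,n\}$ and a positive integer $\kappa$ with $\sum_{u \in N(v)} \ell(u) = \kappa$ for all $v \in V$, where $N(v)$ is the set of neighbors of $v$. For $0 \le j \le n-1$ let $\chi_j(x) = e^{2\pi \mathbf{i} jx/n}$ for $x \in \mathbb{Z}_n$ and $\chi_j(S) = \sum_{s\in S}\chi_j(s)$. Put $\mathcal{A}_n(S) = \{ j \in \{0,1,\dots,n-1\} : \chi_j(S) = 0\}$. Types: for $S=\{\pm a,\pm b,\pm c\}$ with $|S|=6$ and $j \in \mathcal{A}_n(S)$, let $r_a, r_b, r_c \in [0,1]$ be the unique numbers with $\cos(\pi r_s) = \cos(2\pi js/n)$ for $s \in \{a,b,c\}$, and let $r_1 \le r_2 \le r_3$ be these three numbers in nondecreasing order (so $\cos(r_1\pi)+\cos(r_2\pi)+\cos(r_3\pi)=0$). Then $j$ is of type 1 if $0 \le r_1 \le \frac12$, $r_2 =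 \frac12$, $r_3 = 1-r_1$; of type 2 if $0 \le r_1 \le \frac13$, $r_2 = \frac23 - r_1$, $r_3 = \frac23+r_1$; and of type 3 if $(r_1,r_2,r_3) = (\frac15,\frac35,\frac23)$ or $(r_1,r_2,r_3) = (\frac13,\frac25,\frac45)$. *)

(* Defs.v *)
From HB Require Import structures.
From mathcomp Require Import all_boot all_order all_fingroup all_algebra.
From mathcomp Require Import reals trigo complex.

Set Implicit Arguments.
Unset Strict Implicit.
Unset Printing Implicit Defensive.

Import Order.TTheory GRing.Theory Num.Theory.
Local Open Scope ring_scope.

Definition neighbors (V : finType) (e : rel V) (v : V) : {set V} :=
  [set u | e v u].

Definition distance_magic_labeling (V : finType) (e : rel V)
    (l : V -> nat) (k : nat) : Prop :=
  [/\ injective l,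
      (forall m : nat, (1 <= m <= #|V|)%N <-> exists v, l v = m) &
      forall v, (\sum_(u in neighbors e v) l u)%N = k].

Definition distance_magic (V : finType) (e : rel V) : Prop :=
  exists (l : V -> nat) (k : nat),
    (0 < k)%N /\ distance_magic_labeling e l k.

(* 'Z_n is the ring of residues mod n only for 1 < n. *)
Definition circ (n : nat) (S : {set 'Z_n}) : rel 'Z_n :=
  fun i j => j - i \in S.

Definition pm3 (n : nat) (a b c : 'Z_n) : {set 'Z_n} :=
  [set a; - a; b; - b; c; - c].

Definition expi (R : realType) (t : R) : R[i] := Complex (cos t) (sin t).

(* 2 pi j x / n, with x identified with its representative in {0, ..., n-1}. *)
Definition angle (R : realType) (n : nat) (j : 'I_n) (x : 'Z_n) : R :=
  2 * pi * (j * x)%N%:R / n%:R.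

Definition chi (R : realType) (n : nat) (j : 'I_n) (x : 'Z_n) : R[i] :=
  expi (angle R j x).

Definition chi_sum (R : realType) (n : nat) (j : 'I_n) (S : {set 'Z_n}) :
  R[i] := \sum_(s in S) chi R j s.

Definition chi_zeros (R : realType) (n : nat) (S : {set 'Z_n}) : {set 'I_n} :=
  [set j : 'I_n | chi_sum R j S == 0].

(* Since cos is injective on [0, pi], at most one (in fact exactly one) r
   satisfies this. *)
Definition is_ratio (R : realType) (n : nat) (j : 'I_n) (s : 'Z_n) (r : R) :
  Prop := 0 <= r <= 1 /\ cos (pi * r) = cos (angle R j s).

Definition sorted_ratios (R : realType) (n : nat) (a b c : 'Z_n) (j : 'I_n)
    (r1 r2 r3 : R) : Prop :=
  exists ra rb rc : R,
    [/\ is_ratio j a ra, is_ratio j b rb, is_ratio j c rc,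
        perm_eq [:: r1; r2; r3] [:: ra; rb; rc] & r1 <= r2 <= r3].

Definition type1 (R : realType) (n : nat) (a b c : 'Z_n) (j : 'I_n) : Prop :=
  exists r1 r2 r3 : R, sorted_ratios a b c j r1 r2 r3 /\
    [/\ 0 <= r1 <= 1 / 2, r2 = 1 / 2 & r3 = 1 - r1].

Definition type2 (R : realType) (n : nat) (a b c : 'Z_n) (j : 'I_n) : Prop :=
  exists r1 r2 r3 : R, sorted_ratios a b c j r1 r2 r3 /\
    [/\ 0 <= r1 <= 1 / 3, r2 = 2 / 3 - r1 & r3 = 2 / 3 + r1].

Definition type3 (R : realType) (n : nat) (a b c : 'Z_n) (j : 'I_n) : Prop :=
  exists r1 r2 r3 : R, sorted_ratios a b c j r1 r2 r3 /\
    ([/\ r1 = 1 / 5, r2 = 3 / 5 & r3 = 2 / 3] \/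
     [/\ r1 = 1 / 3, r2 = 2 / 5 & r3 = 4 / 5]).

(* Main.v *)
Require Import Defs.
From HB Require Import structures.
From mathcomp Require Import all_boot all_order all_fingroup all_algebra all_field.
From mathcomp Require Import reals trigo complex.
From mathcomp Require Import zify ring lra.

(* The discrete Fourier transform of a distance magic labelling is supported on
   0 and on the set A of all j with chi_j(S) = 0.  Since the labelling is
   injective, every prime p | n misses some j in A; and since its values sum to
   n(n+1)/2, the alternating character forces 4 | n.
   A type 3 element j of A is k n/30 with k coprime to 30, which determines S
   modulo 30: up to sign S consists of some s with 5 | s, and of two elements
   b, c divisible by 3, of the other parity, with b <> +-c modulo 5.
   If p does not divide j in A, and either p^2 | n or p > 6, the Galois
   conjugations 1 + k n/p split the relation chi_j(S) = 0 into one relation for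
   each residue class of S modulo p.  For p = 3 and p = 5 some class is a
   singleton, so 9 and 25 do not divide n.  For p = 2 the class of s gives
   chi_j(s) = +-i, so j is of type 1 and odd.  For p > 6 all possible class
   patterns either give chi_j(s) = +-i again or are contradictory, so
   n | 12 s, which locates s.  An element of type 2 would give
   chi_j(b)^3 = chi_j(+-c)^3 with chi_j(b) <> chi_j(+-c), whereas 3 | b, 3 | c
   and 9 does not divide n. *)

Set Implicit Arguments.
Unset Strict Implicit.
Unset Printing Implicit Defensive.

Import Order.TTheory GRing.Theory Num.Theory.

Local Open Scope ring_scope.

(** * Vanishing sums of roots of unity *)

(** As ['X^n - 1] is the product of the cyclotomic polynomials of the divisors of [n], [z] is a root
    of one with index [d %| n]; then [z ^+ d = 1] forces [d = n]. *)
Lemma root_Cyclotomic_prim (K : numFieldType) (n : nat) (z : K) :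
  (0 < n)%N -> n.-primitive_root z -> root (map_poly intr (Cyclotomic n)) z.
Proof.
move=> n_gt0 prz.
have : root (map_poly intr ('X^n - 1 : {poly int})) z.
  by rewrite rmorphB /= map_polyXn rmorph1 rootE !hornerE prim_expr_order // subrr.
rewrite -(prod_Cyclotomic n_gt0) rmorph_prod /= rootE horner_prod prodf_seq_eq0.
case/hasP=> d; rewrite -dvdn_divisors // => dvd_dn /=; rewrite -rootE => rootd.
have d_gt0 := dvdn_gt0 n_gt0 dvd_dn.
have : root (map_poly intr ('X^d - 1 : {poly int})) z.
  rewrite -(prod_Cyclotomic d_gt0) (big_rem d) /=; last by rewrite -dvdn_divisors.
  by rewrite rmorphM rootM rootd.
rewrite rmorphB /= map_polyXn rmorph1 rootE !hornerE subr_eq0 => /eqP zd1.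
have dvd_nd : (n %| d)%N by rewrite (prim_order_dvd prz) zd1.
suff -> : n = d by [].
by apply/eqP; rewrite eqn_dvd dvd_nd.
Qed.

Lemma map_poly_ratr_intr (K : numFieldType) (P : {poly int}) :
  map_poly ratr (map_poly intr P : {poly rat}) = map_poly intr P :> {poly K}.
Proof. by rewrite -map_poly_comp; apply: eq_map_poly => x /=; rewrite ratr_int. Qed.

(* A polynomial over the rationals vanishing at one primitive [n]-th root has a
   common factor with the cyclotomic polynomial, which is irreducible. *)
Lemma Cyclotomic_dvd_rat (K : numFieldType) (n : nat) (z : K) (P : {poly rat}) :
  (0 < n)%N -> n.-primitive_root z -> root (map_poly ratr P) z ->
  map_poly intr (Cyclotomic n) %| P.
Proof.
move=> n_gt0 prz rootP.
set Q := map_poly intr _ : {poly rat}.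
have ratQ (L : numFieldType) : map_poly ratr Q = map_poly intr (Cyclotomic n) :> {poly L}.
  exact: map_poly_ratr_intr.
pose G := gcdp P Q.
have rootG : root (map_poly ratr G) z.
  by rewrite gcdp_map root_gcd rootP ratQ root_Cyclotomic_prim.
have P0 : Q != 0.
  by rewrite map_poly_eq0_id0 ?intr_eq0 ?monic_neq0 ?Cyclotomic_monic //
     (monicP (Cyclotomic_monic n)).
have G0 : G != 0 by rewrite gcdp_eq0 negb_and P0 orbT.
(* The gcd has a root in [K], so it is not constant and has a root in [algC] too, where the minimal
   polynomial of a primitive root is known to be cyclotomic. *)
have szG : size (map_poly (ratr : rat -> algC) G) != 1%N.
  rewrite size_map_poly; apply: contraTneq rootG => szG.
  apply: contra_eqN szG; rewrite -(size_map_poly (ratr : {rmorphism rat -> K})).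
  by move/root_size_gt1; rewrite map_poly_eq0 => /(_ G0); case: size => [|[]].
have [w rootw] := closed_rootP _ szG.
move: rootw; rewrite gcdp_map root_gcd ratQ => /andP[rootwP rootwQ].
have [w0 prw0] := C_prim_root_exists n_gt0.
have prw : n.-primitive_root w.
  by rewrite -(root_cyclotomic prw0) -(Cintr_Cyclotomic prw0).
have [q [Dq _] dv_q] := minCpolyP w.
suff -> : Q = q by rewrite -dv_q.
apply: (map_poly_inj (ratr : {rmorphism rat -> algC})) => /=.
by rewrite -Dq ratQ (minCpoly_cyclotomic prw) (Cintr_Cyclotomic prw).
Qed.

(** Galois conjugation without automorphisms: the sum is the value at [z] of a rational polynomial,
    which the cyclotomic polynomial divides, and that one also vanishes at [z ^+ u]. *)
Lemma sum_exp_coprime (K : numFieldType) (n : nat) (z : K) (T : seq nat) (u : nat) :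
  (0 < n)%N -> n.-primitive_root z -> coprime u n ->
  \sum_(t <- T) z ^+ t = 0 -> \sum_(t <- T) z ^+ (u * t) = 0.
Proof.
move=> n_gt0 prz cun sum0.
pose P : {poly rat} := \sum_(t <- T) 'X^t.
have PE x : (map_poly ratr P).[x] = \sum_(t <- T) x ^+ t :> K.
  rewrite rmorph_sum horner_sum; apply: eq_bigr => t _ /=.
  by rewrite map_polyXn hornerXn.
have rootP : root (map_poly ratr P) z by rewrite rootE PE sum0.
have := Cyclotomic_dvd_rat n_gt0 prz rootP => /dvdpP[q Pq].
under eq_bigr => t _ do rewrite exprM.
rewrite -PE Pq rmorphM hornerM /= map_poly_ratr_intr.
apply/eqP; rewrite mulf_eq0; apply/orP; right.
by apply: root_Cyclotomic_prim; rewrite ?prim_root_exp_coprime.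
Qed.

(* The conjugations [z |-> z ^+ (1 + k n / p)] separate the residue classes
   modulo [p]; when [p] divides [n] exactly one of the [k < p] is lost, and the
   empty class makes up for it. *)
Lemma class_sum_eq0_last_empty (K : numFieldType) (n p : nat) (z : K)
    (T : seq nat) (r : nat) :
  (0 < n)%N -> n.-primitive_root z -> prime p -> (p %| n)%N ->
  (p ^ 2 %| n)%N || all (fun t => t %% p != p.-1)%N T ->
  \sum_(t <- T) z ^+ t = 0 ->
  \sum_(t <- T | t == r %[mod p]) z ^+ t = 0.
Proof.
move=> n_gt0 prz pr_p dvd_pn hT sum0.
have p_gt0 := prime_gt0 pr_p; set m := (n %/ p)%N.
have Dn : n = (p * m)%N by rewrite mulnC divnK.
have prw : p.-primitive_root (z ^+ m) by exact: dvdn_prim_root.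
(* The class sums [f i] are the coefficients of [Q]. Conjugating by [1 + k * m] evaluates [Q] at the
   [k]-th power of the [p]-th root of unity [z ^+ m]; enough roots force [Q = 0]. *)
pose f i := \sum_(t <- T | (t %% p == i)%N) z ^+ t.
pose Q := \poly_(i < p) f i.
pose ks := [seq k <- iota 0 p | ~~ (p %| 1 + k * m)%N].
have rootQ : all (root Q) [seq (z ^+ m) ^+ k | k <- ks].
  apply/allP => y /mapP[k]; rewrite mem_filter => /andP[ndv _] ->.
  have cop : coprime (1 + k * m) n.
    by rewrite Dn coprimeMr coprime_sym prime_coprime // ndv /coprime gcdnC addnC gcdnMDl gcdn1.
  rewrite rootE horner_poly -[X in _ == X](sum_exp_coprime n_gt0 prz cop sum0).
  have -> : \sum_(t <- T) z ^+ ((1 + k * m) * t) =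
      \sum_(t <- T) \sum_(i < p | (t %% p == i)%N) z ^+ t * (z ^+ m ^+ k) ^+ i.
    apply: eq_bigr => t _.
    rewrite (big_pred1 (Ordinal (ltn_pmod t p_gt0))); last first.
      by move=> i; rewrite /= -val_eqE /= eq_sym.
    rewrite /= mulnDl mul1n exprD; congr (_ * _).
    rewrite -(exprM (z ^+ m)) -(prim_expr_mod prw (k * _)).
    by rewrite modnMmr (prim_expr_mod prw) -exprM mulnA (mulnC m).
  rewrite (exchange_big_dep xpredT) //=; apply/eqP; apply: eq_bigr => i _.
  by rewrite mulr_suml.
have uniq_ks : uniq [seq (z ^+ m) ^+ k | k <- ks].
  rewrite map_inj_in_uniq ?filter_uniq ?iota_uniq // => k l.
  rewrite !mem_filter !mem_iota !add0n => /andP[_ ltk] /andP[_ ltl] /eqP.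
  by rewrite (eq_prim_root_expr prw) !modn_small // => /eqP.
have szQ : (size Q <= size [seq (z ^+ m) ^+ k | k <- ks])%N.
  (* If [p] divides [m], all [p] values of [k] are admissible. Otherwise the empty class [p.-1]
     lowers the size of [Q] to at most [p.-1]. *)
  rewrite size_map; case/orP: hT => [p2n|/allP hT].
    have dvd_pm : (p %| m)%N by rewrite -(dvdn_pmul2l p_gt0) -Dn mulnn.
    rewrite /ks; under eq_filter => k do
      rewrite dvdn_addl ?dvdn_mull // dvdn1 (gtn_eqF (prime_gt1 pr_p)).
    by rewrite filter_predT size_iota size_poly.
  have szQ1 : (size Q <= p.-1)%N.
    apply/leq_sizeP => i lepi; rewrite coef_poly; case: ltnP => // ltip.
    have -> : i = p.-1 by apply/eqP; rewrite eqn_leq lepi -ltnS prednK ?ltip.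
    by rewrite /f big_seq_cond big1 // => t /andP[/hT /negPf ->].
  apply: leq_trans szQ1 _.
  have := count_predC (fun k => (p %| 1 + k * m)%N) (iota 0 p).
  rewrite size_iota -[count (predC _) _]size_filter -/ks.
  (* Two inadmissible [k] would differ by a multiple of [p], since [p] cannot divide [m]. *)
  suff : (count (fun k => p %| 1 + k * m) (iota 0 p) <= 1)%N.
    by move=> le1 E; rewrite -ltnS prednK // -{1}E; apply: leq_add le1 _.
  rewrite -size_filter; set bad := filter _ _.
  have ubad : uniq bad by rewrite filter_uniq ?iota_uniq.
  have badP k : k \in bad -> (p %| 1 + k * m)%N /\ (k < p)%N.
    by rewrite mem_filter mem_iota add0n => /andP[? /andP[]].
  case: bad ubad badP => [|k1 [|k2 l]] //= /andP[+ _] badP.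
  rewrite inE negb_or => /andP[/eqP k12 _].
  have [d1 lt1] := badP k1 (mem_head _ _).
  have [|d2 lt2] := badP k2; first by rewrite !inE eqxx orbT.
  have pm : ~~ (p %| m)%N.
    by apply: contraL d1 => d; rewrite dvdn_addl ?dvdn_mull // dvdn1 (gtn_eqF (prime_gt1 pr_p)).
  case: k12; wlog le12 : k1 k2 d1 d2 lt1 lt2 {badP} / (k1 <= k2)%N.
    by case/orP: (leq_total k1 k2) => h wl; [|symmetry]; apply: wl.
  have : (p %| (k2 - k1) * m)%N.
    by rewrite mulnBl -(subnDl 1) dvdn_sub.
  rewrite Euclid_dvdM // (negPf pm) orbF => dv; apply/eqP.
  rewrite eqn_leq le12 -subn_eq0; apply: contraLR dv; rewrite -lt0n => lt.
  by rewrite gtnNdvd // (leq_ltn_trans (leq_subr _ _)).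
have Q0 := roots_geq_poly_eq0 rootQ uniq_ks szQ.
have := coef_poly p f (r %% p); rewrite -/Q Q0 coef0 ltn_pmod // => <-.
Qed.

(** Fewer than [p] terms leave some class [r0] empty; multiplying the relation by [z ^+ (p.-1 - r0)]
    moves this class to [p.-1]. *)
Lemma class_sum_eq0 (K : numFieldType) (n p : nat) (z : K) (T : seq nat) (r : nat) :
  (0 < n)%N -> n.-primitive_root z -> prime p -> (p %| n)%N ->
  (p ^ 2 %| n)%N || (size T < p)%N ->
  \sum_(t <- T) z ^+ t = 0 ->
  \sum_(t <- T | t == r %[mod p]) z ^+ t = 0.
Proof.
move=> n_gt0 prz pr_p dvd_pn hT sum0; have p_gt0 := prime_gt0 pr_p.
case/orP: hT => [p2n|szT]; first by apply: (@class_sum_eq0_last_empty _ n); rewrite ?p2n.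
have [r0 ltr0 nr0] : exists2 r0, (r0 < p)%N & r0 \notin [seq (t %% p)%N | t <- T].
  have : ~~ all (mem [seq (t %% p)%N | t <- T]) (iota 0 p).
    apply: contraL szT => /allP sub; rewrite -leqNgt.
    by rewrite -(size_iota 0 p) -(size_map (modn^~ p) T) uniq_leq_size ?iota_uniq.
  by case/allPn => r0; rewrite mem_iota => ? ?; exists r0.
pose c := (p.-1 - r0)%N.
have z0 : z ^+ c != 0 by rewrite expf_neq0 // (prim_root_eq0 prz) -lt0n.
have := @class_sum_eq0_last_empty _ n p z [seq (t + c)%N | t <- T] (r + c)
  n_gt0 prz pr_p dvd_pn.
rewrite !big_map; under eq_bigr => t _ do rewrite exprD.
under [X in _ -> _ -> X = _]eq_bigr => t _ do rewrite exprD.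
under [X in _ -> _ -> X = _]eq_bigl => t do rewrite eqn_modDr.
rewrite -!mulr_suml sum0 mul0r => H; apply/eqP.
rewrite -(mulIr_eq0 _ (mulIf z0)) H //; apply/orP; right.
rewrite all_map; apply/allP => t tT /=; apply: contra nr0 => /eqP ht.
apply/mapP; exists t => //.
have : (t + c = r0 + c %[mod p])%N.
  by rewrite ht /c subnKC ?modn_small // ?ltn_predL // -ltnS prednK.
by move/eqP; rewrite eqn_modDr (modn_small ltr0) => /eqP.
Qed.

(** * Class sums for three pairs of opposite exponents *)

Lemma eqmod_subl (p n b r : nat) :
  (p %| n)%N -> (b <= n)%N -> (n - b == r %[mod p])%N = (p %| b + r)%N.
Proof.
move=> dvd_pn le_bn; rewrite -(eqn_modDl b) subnKC // eq_sym.
by rewrite (eqP dvd_pn).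
Qed.

Lemma eqmod_mull_prime (p j s t : nat) : prime p -> ~~ (p %| j)%N ->
  (j * t == j * s %[mod p])%N = (t == s %[mod p])%N.
Proof.
move=> pr_p pj; wlog le_st : s t / (s <= t)%N.
  by move=> wl; case/orP: (leq_total s t) => /wl //; rewrite eq_sym => ->; rewrite eq_sym.
rewrite !eqn_mod_dvd ?leq_mul2l ?le_st ?orbT // -mulnBr Euclid_dvdM //.
by rewrite (negPf pj).
Qed.

Lemma expr_sub_order (K : fieldType) (X : K) (n a : nat) :
  X ^+ n = 1 -> (a <= n)%N -> X ^+ (n - a) = (X ^+ a)^-1.
Proof.
move=> Xn1 le_an; have : X ^+ (n - a) * X ^+ a = 1 by rewrite -exprD subnK.
move=> h; have nz : X ^+ a != 0.
  by apply: contra_eq_neq h => ->; rewrite mulr0 eq_sym oner_neq0.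
by rewrite -[RHS]mul1r -h mulfK.
Qed.

Section ClassSums.

Variables (K : numFieldType) (n p j : nat) (z : K) (a b c : nat).
Hypotheses (n_gt0 : (0 < n)%N) (prz : n.-primitive_root z).
Hypotheses (pr_p : prime p) (dvd_pn : (p %| n)%N) (ndvd_pj : ~~ (p %| j)%N).
Hypothesis hp : (p ^ 2 %| n)%N || (6 < p)%N.
Hypotheses (le_an : (a <= n)%N) (le_bn : (b <= n)%N) (le_cn : (c <= n)%N).

Local Notation x := (z ^+ j ^+ a).
Local Notation y := (z ^+ j ^+ b).
Local Notation w := (z ^+ j ^+ c).

Hypothesis sum0 : x + x^-1 + (y + y^-1) + (w + w^-1) = 0.

(** The opposite of [a] is represented by the exponent [n - a]. Since [p] does not divide [j],
    multiplication by [j] permutes the classes modulo [p]; the boolean multiplicities select the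
    terms in the class of [r]. *)
Lemma class_sum6 (r : nat) :
  x *+ (a == r %[mod p])%N + x^-1 *+ (p %| a + r)%N
  + (y *+ (b == r %[mod p])%N + y^-1 *+ (p %| b + r)%N)
  + (w *+ (c == r %[mod p])%N + w^-1 *+ (p %| c + r)%N) = 0.
Proof.
have zjn : z ^+ j ^+ n = 1 by rewrite exprAC (prim_expr_order prz) expr1n.
have := @class_sum_eq0 _ n p z
  [seq (j * t)%N | t <- [:: a; n - a; b; n - b; c; n - c]%N] (j * r)
  n_gt0 prz pr_p dvd_pn hp.
rewrite !big_map /= => class0; rewrite -[RHS]class0.
  under [RHS]eq_bigl => t do rewrite eqmod_mull_prime //.
  under [RHS]eq_bigr => t _ do rewrite exprM.
  rewrite [RHS]big_mkcond /= !big_cons big_nil !eqmod_subl // !expr_sub_order // addr0.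
  by rewrite !addrA !mulrb.
under eq_bigr => t _ do rewrite exprM.
by rewrite !big_cons big_nil !expr_sub_order // addr0 -sum0 !addrA.
Qed.

(** This is the relation for the class of [- r], represented by [n - r]. *)
Lemma class_sum6V (r : nat) : (r <= n)%N ->
  x^-1 *+ (a == r %[mod p])%N + x *+ (p %| a + r)%N
  + (y^-1 *+ (b == r %[mod p])%N + y *+ (p %| b + r)%N)
  + (w^-1 *+ (c == r %[mod p])%N + w *+ (p %| c + r)%N) = 0.
Proof.
move=> le_rn; have := class_sum6 (n - r).
have e1 s : (s == n - r %[mod p])%N = (p %| s + r)%N by rewrite eq_sym eqmod_subl // addnC.
have e2 s : (p %| s + (n - r))%N = (s == r %[mod p])%N.
  by rewrite -(eqn_modDr (n - r) s) subnKC // (eqP dvd_pn).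
by rewrite !e1 !e2 => <-; congr (_ + _ + _); exact: addrC.
Qed.

(** The class of [a] would consist of the single term [x], which is not zero. *)
Lemma class_not_isolated :
  ~~ (p %| a + a)%N -> (b != a %[mod p])%N -> ~~ (p %| b + a)%N ->
  (c != a %[mod p])%N -> ~~ (p %| c + a)%N -> False.
Proof.
move=> /negPf ha /negPf hba /negPf hba' /negPf hca /negPf hca'.
have := class_sum6 a; rewrite eqxx ha hba hba' hca hca' /= !addr0 => /eqP.
by rewrite !expf_eq0 (prim_root_eq0 prz) (gtn_eqF n_gt0) !andbF.
Qed.

Lemma class_pair :
  (p %| a + a)%N -> (b != a %[mod p])%N -> ~~ (p %| b + a)%N ->
  (c != a %[mod p])%N -> ~~ (p %| c + a)%N -> x + x^-1 = 0.
Proof.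
move=> ha /negPf hba /negPf hba' /negPf hca /negPf hca'.
by have := class_sum6 a; rewrite eqxx ha hba hba' hca hca' /= !addr0.
Qed.

End ClassSums.

(** * Identities between a few roots of unity *)

Lemma addrV_eq0 (K : fieldType) (x : K) : x != 0 -> (x + x^-1 == 0) = (x ^+ 2 == -1).
Proof.
move=> x0; rewrite -(inj_eq (mulIf x0)) mulrDl mulVf // mul0r -expr2 addr_eq0.
by [].
Qed.

(** Raising to the even power [c * 2] turns [X ^+ a] and [X ^+ b] into [(-1) ^+ a] and [(-1) ^+ b]
    and removes the minus sign, so [a] and [b] would have the same parity. *)
Lemma root_parity_contra (K : numFieldType) (X : K) (a b c : nat) :
  odd (a + b) -> X ^+ c ^+ 2 = -1 ->
  X ^+ a = - X ^+ b \/ X ^+ a = - (X ^+ b)^-1 -> False.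
Proof.
move=> odd_ab Xc.
have neq1 : (-1 : K) != 1.
  by rewrite -subr_eq0 -opprD oppr_eq0 -(natrD _ 1 1) pnatr_eq0.
have X0 : X != 0.
  apply/eqP => X0; move: Xc; rewrite X0 -exprM expr0n; case: eqP => _ /eqP.
    by rewrite eq_sym (negPf neq1).
  by rewrite eq_sym oppr_eq0 oner_eq0.
have Xt t : X ^+ t ^+ (c * 2) = (-1) ^+ t by rewrite exprAC exprM Xc.
have c2 : ~~ odd (c * 2) by rewrite oddM andbF.
case=> /(congr1 (fun t => t ^+ (c * 2))); rewrite exprNn -signr_odd (negPf c2) mul1r ?exprVn !Xt.
  rewrite -(signr_odd _ a) -(signr_odd _ b); move: odd_ab; rewrite oddD.
  by case: (odd a); case: (odd b) => //= _ /eqP; rewrite ?expr0 ?expr1 ?[1 == _]eq_sym (negPf neq1).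
rewrite -(signr_odd _ a) -(signr_odd _ b); move: odd_ab; rewrite oddD.
case: (odd a); case: (odd b) => //= _ /eqP;
  by rewrite ?expr0 ?expr1 ?invrN ?invr1 ?[1 == _]eq_sym (negPf neq1).
Qed.

Lemma cube_inj_coprime (K : fieldType) (m : nat) (u v : K) :
  coprime 3 m -> u ^+ m = 1 -> v ^+ m = 1 -> u ^+ 3 = v ^+ 3 -> u = v.
Proof.
move=> cop um vm uv3.
have [km kn Dk _] := @egcdnP 3 m isT; rewrite (eqP cop) in Dk.
have pow t : t ^+ m = 1 -> t = t ^+ 3 ^+ km.
  by move=> tm; rewrite -exprM mulnC Dk exprD mulnC exprM tm expr1n mul1r.
by rewrite [u]pow // uv3 -pow.
Qed.

(** Exponents divisible by 3 give roots of unity of order dividing [n / 3], which is prime to 3, and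
    cubing is injective on those. *)
Lemma root_cube_inj (K : fieldType) (X e1 e2 : K) (n b c : nat) :
  X ^+ n = 1 -> (3 %| n)%N -> ~~ (9 %| n)%N -> (3 %| b)%N -> (3 %| c)%N ->
  e1 = X ^+ b \/ e1 = (X ^+ b)^-1 -> e2 = X ^+ c \/ e2 = (X ^+ c)^-1 ->
  e1 ^+ 3 = e2 ^+ 3 -> e1 = e2.
Proof.
move=> Xn /dvdnP[m Dn] n9 b3 c3 he1 he2.
have cop : coprime 3 m.
  by rewrite prime_coprime //; apply: contra n9 => m3; rewrite Dn (@dvdn_mul 3 3).
have pow t : (3 %| t)%N -> X ^+ t ^+ m = 1.
  by case/dvdnP=> q ->; rewrite -exprM -mulnA (mulnC 3) -Dn mulnC exprM Xn expr1n.
apply: (cube_inj_coprime cop); first by case: he1 => ->; rewrite ?exprVn pow ?invr1.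
by case: he2 => ->; rewrite ?exprVn pow ?invr1.
Qed.

(** The first two elementary symmetric functions of [x], [y], [w] vanish, so the three have the same
    cube; [y = w] would give [3 * y ^+ 2 = 0]. *)
Lemma sum3_roots_cube (K : numFieldType) (x y w : K) :
  x != 0 -> y != 0 -> w != 0 ->
  x + y + w = 0 -> x^-1 + y^-1 + w^-1 = 0 -> y ^+ 3 = w ^+ 3 /\ y <> w.
Proof.
move=> x0 y0 w0 s1 s2.
have Dx : x = - (y + w) by apply/eqP; rewrite -subr_eq0 opprK addrA s1.
have s3 : y * w + x * w + x * y = 0.
  have -> : y * w + x * w + x * y = x * y * w * (x^-1 + y^-1 + w^-1) by field; rewrite x0 y0 w0.
  by rewrite s2 mulr0.
have s4 : y ^+ 2 + y * w + w ^+ 2 = 0.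
  have -> : y ^+ 2 + y * w + w ^+ 2 = - (y * w + x * w + x * y) by rewrite Dx; ring.
  by rewrite s3 oppr0.
split=> [|yw].
  apply/eqP; rewrite -subr_eq0; apply/eqP.
  have -> : y ^+ 3 - w ^+ 3 = (y - w) * (y ^+ 2 + y * w + w ^+ 2) by ring.
  by rewrite s4 mulr0.
have : 3%:R * y ^+ 2 = 0 by rewrite -s4 -yw; ring.
by move/eqP; rewrite mulf_eq0 pnatr_eq0 expf_eq0 (negPf y0) andbF.
Qed.

(** * Primes larger than 6 *)

Section LargePrime.

Variables (K : numFieldType) (n p j : nat) (z : K) (a b c : nat).
Hypotheses (n_gt0 : (0 < n)%N) (prz : n.-primitive_root z).
Hypotheses (pr_p : prime p) (dvd_pn : (p %| n)%N) (ndvd_pj : ~~ (p %| j)%N).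
Hypothesis p6 : (6 < p)%N.
Hypotheses (le_an : (a <= n)%N) (le_bn : (b <= n)%N) (le_cn : (c <= n)%N).

Local Notation x := (z ^+ j ^+ a).
Local Notation y := (z ^+ j ^+ b).
Local Notation w := (z ^+ j ^+ c).

Hypothesis sum0 : x + x^-1 + (y + y^-1) + (w + w^-1) = 0.

Let hp : (p ^ 2 %| n)%N || (6 < p)%N. Proof. by rewrite p6 orbT. Qed.

Let dbl t : (p %| t + t)%N = (p %| t)%N.
Proof.
by rewrite addnn -muln2 Euclid_dvdM // [(p %| 2)%N]gtnNdvd ?orbF // (leq_trans _ p6).
Qed.

(** The class of [a] holds just one more term, so [x = - y] or [x = - y^-1]. The class of [c] holds
    only [w] and possibly [w^-1], so [w ^+ 2 = -1], against [root_parity_contra]. *)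
Lemma class_sum_pair_contra :
  ~~ (p %| a)%N -> odd (a + b) ->
  (b == a %[mod p])%N || (p %| b + a)%N ->
  ~~ ((c == a %[mod p])%N || (p %| c + a)%N) -> False.
Proof.
move=> pa oab hb; rewrite negb_or => /andP[hc hc'].
have z0 t : z ^+ j ^+ t != 0.
  by rewrite !expf_eq0 (prim_root_eq0 prz) (gtn_eqF n_gt0) !andbF.
have cs := class_sum6 n_gt0 prz pr_p dvd_pn ndvd_pj hp le_an le_bn le_cn sum0.
have sa := cs a.
rewrite eqxx dbl (negPf pa) (negPf hc) (negPf hc') /= !addr0 in sa.
have xy : x = - y \/ x = - y^-1.
  case/boolP: (b == a %[mod p])%N hb sa => [ba _|_ /= ->].
    rewrite /dvdn -modnDml (eqP ba) modnDml -/(dvdn _ _) dbl (negPf pa) /= addr0.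
    by move/eqP; rewrite addr_eq0 => /eqP; left.
  by rewrite add0r => /eqP; rewrite addr_eq0 => /eqP; right.
have bc : (b == c %[mod p])%N = false /\ (p %| b + c)%N = false.
  have cba t u : (p %| t + u)%N -> (p %| t + c)%N = (c == u %[mod p])%N.
    by move=> tu; rewrite -(eqn_modDl t c u) (eqP tu).
  have bca t u : (p %| t + u)%N -> (t == c %[mod p])%N = (p %| c + u)%N.
    by move=> tu; rewrite -(eqn_modDr u t c) (eqP tu) eq_sym.
  case/orP: hb => hb; last by rewrite (cba _ _ hb) (bca _ _ hb) (negPf hc) (negPf hc').
  rewrite (eqP hb) eq_sym (negPf hc); split=> //.
  by rewrite /dvdn -modnDml (eqP hb) modnDml addnC; exact: negPf.
have := cs c; rewrite bc.1 bc.2 eqxx [(a == c %[mod p])%N]eq_sym.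
rewrite (negPf hc) [(a + c)%N]addnC (negPf hc') dbl /= !add0r.
have [pc|_] := boolP (p %| c)%N; last by rewrite addr0 => /eqP; rewrite (negPf (z0 c)).
move/eqP; rewrite !mulr1n addrV_eq0 // => /eqP w2.
exact: (root_parity_contra oab w2 xy).
Qed.

End LargePrime.

(* Comparing residue classes modulo a prime [p >= 7]: unless [a] is isolated
   or paired with [-a], it is congruent to [b] or [c] up to sign, which leads
   to a pair of opposite roots of unity with exponents of different parity, or
   to three roots of unity forming an equilateral triangle. *)
Lemma class_sum_large_prime (K : numFieldType) (n p j : nat) (z : K) (a b c : nat) :
  (0 < n)%N -> n.-primitive_root z -> prime p -> (p %| n)%N -> ~~ (p %| j)%N ->
  (6 < p)%N -> (a <= n)%N -> (b <= n)%N -> (c <= n)%N ->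
  z ^+ j ^+ a + (z ^+ j ^+ a)^-1 + (z ^+ j ^+ b + (z ^+ j ^+ b)^-1)
    + (z ^+ j ^+ c + (z ^+ j ^+ c)^-1) = 0 ->
  ~~ [&& p %| a, p %| b & p %| c]%N ->
  odd (a + b) -> odd (a + c) ->
  (3 %| n)%N -> ~~ (9 %| n)%N -> (3 %| b)%N -> (3 %| c)%N ->
  z ^+ j ^+ a ^+ 2 = -1.
Proof.
move=> n_gt0 prz pr_p dvd_pn ndvd_pj p6 le_an le_bn le_cn sum0 nall oab oac n3 n9 b3 c3.
have hp : (p ^ 2 %| n)%N || (6 < p)%N by rewrite p6 orbT.
have z0 t : z ^+ j ^+ t != 0.
  by rewrite !expf_eq0 (prim_root_eq0 prz) (gtn_eqF n_gt0) !andbF.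
have zjn : z ^+ j ^+ n = 1 by rewrite exprAC (prim_expr_order prz) expr1n.
have dbl t : (p %| t + t)%N = (p %| t)%N.
  by rewrite addnn -muln2 Euclid_dvdM // [(p %| 2)%N]gtnNdvd ?orbF // (leq_trans _ p6).
pose cs := @class_sum6 K n p j z a b c n_gt0 prz pr_p dvd_pn ndvd_pj hp le_an le_bn le_cn sum0.
pose csV := @class_sum6V K n p j z a b c n_gt0 prz pr_p dvd_pn ndvd_pj hp le_an le_bn le_cn sum0.
have mod0 t : (t == 0 %[mod p])%N = (p %| t)%N by rewrite mod0n.
apply/eqP; rewrite -addrV_eq0 //; apply/eqP.
(* If [p] divides [a], look at the class of 0: when exactly one of [b], [c] also lies in it, the
   other one is isolated; when neither does, the class gives [x + x^-1 = 0]. *)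
have [pa|pa] := boolP (p %| a)%N.
  have := cs 0%N; rewrite !mod0 !addn0 pa.
  have eqa t : (a == t %[mod p])%N = (p %| t)%N by rewrite (eqP pa) eq_sym.
  have adda t : (p %| a + t)%N = (p %| t)%N by rewrite dvdn_addr.
  have [pb|pb] := boolP (p %| b)%N.
    have pc : ~~ (p %| c)%N by apply: contra nall => pc; rewrite pa pb.
    have := cs c; rewrite eqa adda (negPf pc) eqxx dbl (negPf pc) dvdn_addr // (negPf pc).
    rewrite (eqP pb) [(0 == _)%N]eq_sym [(_ == 0)%N](negPf pc) /= !add0r addr0.
    by move/eqP; rewrite (negPf (z0 c)).
  have [pc|pc] := boolP (p %| c)%N; last by rewrite /= !addr0.
  have := cs b; rewrite eqa adda (negPf pb) eqxx dbl (negPf pb) dvdn_addr // (negPf pb).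
  rewrite (eqP pc) [(0 == _)%N]eq_sym [(_ == 0)%N](negPf pb) /= !add0r !addr0.
  by move/eqP; rewrite (negPf (z0 b)).
exfalso.
have sgn t : (t == a %[mod p])%N -> (p %| t + a)%N = false.
  by move=> ta; rewrite /dvdn -modnDml (eqP ta) modnDml -/(dvdn _ _) dbl (negPf pa).
have sa := cs a; have saV := csV a le_an.
rewrite eqxx dbl (negPf pa) /= addr0 in sa saV.
have sum0' : z ^+ j ^+ a + (z ^+ j ^+ a)^-1 + (z ^+ j ^+ c + (z ^+ j ^+ c)^-1)
    + (z ^+ j ^+ b + (z ^+ j ^+ b)^-1) = 0 by rewrite addrAC.
have bothP : {(b == a %[mod p])%N || (p %| b + a)%N} + {~~ ((b == a %[mod p])%N || (p %| b + a)%N)}.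
  by case: (_ || _); [left|right].
case: bothP => hb; last first.
  have [hc|hc] := boolP ((c == a %[mod p])%N || (p %| c + a)%N).
    exact: (class_sum_pair_contra n_gt0 prz pr_p dvd_pn ndvd_pj p6 le_an le_cn le_bn sum0' pa).
  move: hb hc; rewrite !negb_or => /andP[hb hb'] /andP[hc hc'].
  by apply: (class_not_isolated n_gt0 prz pr_p dvd_pn ndvd_pj hp le_an le_bn le_cn sum0);
    rewrite ?dbl.
have [hc|hc] := boolP ((c == a %[mod p])%N || (p %| c + a)%N); last first.
  exact: (class_sum_pair_contra n_gt0 prz pr_p dvd_pn ndvd_pj p6 le_an le_bn le_cn sum0 pa).
(* Here [b] and [c] are both congruent to [a] up to sign. The classes of [a] and [- a] give a
   vanishing sum of three roots of unity and of their inverses, for each of the four sign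
   patterns. *)
have contra_triangle e1 e2 :
    e1 = z ^+ j ^+ b \/ e1 = (z ^+ j ^+ b)^-1 ->
    e2 = z ^+ j ^+ c \/ e2 = (z ^+ j ^+ c)^-1 ->
    z ^+ j ^+ a + e1 + e2 = 0 -> (z ^+ j ^+ a)^-1 + e1^-1 + e2^-1 = 0 -> False.
  move=> he1 he2 s1 s2.
  have nz1 : e1 != 0 by case: he1 => ->; rewrite ?invr_eq0.
  have nz2 : e2 != 0 by case: he2 => ->; rewrite ?invr_eq0.
  have [e ne] := sum3_roots_cube (z0 a) nz1 nz2 s1 s2.
  exact: ne (root_cube_inj zjn n3 n9 b3 c3 he1 he2 e).
case/boolP: (b == a %[mod p])%N hb sa saV => [bp _|_ /= ->];
  case/boolP: (c == a %[mod p])%N hc => [cp _|_ /= ->];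
  rewrite ?(sgn b bp) ?(sgn c cp) /= ?mulr1n ?mulr0n ?add0r ?addr0.
- by apply: contra_triangle; left.
- by rewrite -{2}(invrK (z ^+ j ^+ c)); apply: contra_triangle; [left|right].
- by rewrite -{2}(invrK (z ^+ j ^+ b)); apply: contra_triangle; [right|left].
rewrite -{2}(invrK (z ^+ j ^+ b)) -{2}(invrK (z ^+ j ^+ c)).
by apply: contra_triangle; right.
Qed.

(** * Fourier analysis of distance magic labellings *)

Lemma val_ZpD (n : nat) (x y : 'Z_n) : (1 < n)%N -> (x + y)%R = ((x + y) %% n)%N :> nat.
Proof. by move=> n_gt1; rewrite /= [X in (_ %% X)%N]Zp_cast. Qed.

Lemma val_ZpN (n : nat) (x : 'Z_n) : (1 < n)%N -> (- x)%R = ((n - x) %% n)%N :> nat.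
Proof. by move=> n_gt1; rewrite /= [X in (_ %% X)%N]Zp_cast // [X in (X - _)%N]Zp_cast. Qed.

Lemma ltn_Zp (n : nat) (x : 'Z_n) : (1 < n)%N -> (x < n)%N.
Proof. by move=> n_gt1; rewrite -[X in (_ < X)%N](Zp_cast n_gt1). Qed.

Lemma circ_magic_sum (n : nat) (S : {set 'Z_n}) (l : 'Z_n -> nat) (k : nat) :
  distance_magic_labeling (circ S) l k ->
  forall v, (\sum_(s in S) l (v + s)%R)%N = k.
Proof.
case=> _ _ hk v; rewrite -(hk v) [RHS](reindex_inj (addrI v)) /=.
by apply: eq_bigl => s; rewrite inE /circ addrC addKr.
Qed.

Lemma double_sum_iota1 (n : nat) : ((\sum_(i <- iota 1 n) i) * 2 = n * n.+1)%N.
Proof.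
elim: n => [|n IHn]; first by rewrite big_nil.
by rewrite -(addn1 n) iotaD big_cat big_seq1 /= mulnDl IHn; lia.
Qed.

Lemma sum_labeling (V : finType) (e : rel V) (l : V -> nat) (k : nat) :
  distance_magic_labeling e l k -> ((\sum_v l v) * 2 = #|V| * #|V|.+1)%N.
Proof.
case=> l_inj l_im _; rewrite -double_sum_iota1; congr (_ * 2)%N.
rewrite -(big_map l xpredT id); apply: perm_big.
apply: uniq_perm; rewrite ?iota_uniq ?map_inj_uniq ?index_enum_uniq // => m.
rewrite mem_iota add1n ltnS; apply/mapP/idP => [[v _ ->]|/l_im[v <-]].
  by apply/l_im; exists v.
by exists v; rewrite ?mem_index_enum.
Qed.

Section Characters.

Variables (K : fieldType) (V : finZmodType) (psi : V -> K).
Hypothesis psiD : {morph psi : x y / x + y >-> x * y}.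

Lemma sum_character_eq0 (y : V) : psi y != 1 -> \sum_x psi x = 0.
Proof.
move=> hy; apply/eqP; have : (psi y - 1) * \sum_x psi x == 0.
  rewrite mulrBl mul1r mulr_sumr subr_eq0; apply/eqP.
  by rewrite [RHS](reindex_inj (addrI y)); apply: eq_bigr => x _; rewrite psiD.
by rewrite mulf_eq0 subr_eq0 (negPf hy).
Qed.

(** The magic condition says that a convolution of [l] with the indicator of [S] is constant. Its
    transform at a nontrivial character is 0, and is also the product of the two transforms. *)
Lemma magic_fourier_eq0 (S : {set V}) (l : V -> nat) (k : nat) (y : V) :
  (forall v, (\sum_(s in S) l (v + s)%R)%N = k) -> psi y != 1 ->
  \sum_(s in S) psi (- s) != 0 -> \sum_x (l x)%:R * psi x = 0.
Proof.
move=> hk hy hS; apply/eqP; rewrite -(mulIr_eq0 _ (mulIf hS)) mulr_sumr.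
rewrite (eq_bigr (fun s => \sum_x (l (x + s))%:R * psi x)); last first.
  move=> s _; rewrite mulr_suml (reindex_inj (addIr s)).
  by apply: eq_bigr => x _; rewrite -mulrA -psiD addrK.
rewrite exchange_big /=.
under eq_bigr => x _ do rewrite -mulr_suml -natr_sum hk.
by rewrite -mulr_sumr (sum_character_eq0 hy) mulr0.
Qed.

End Characters.

(** At the alternating character the transform of [l] vanishes, so the labels at even and at odd
    vertices have the same sum [E]. Then [4 * E = n * n.+1] with [n.+1] odd. *)
Lemma magic_even_order_dvd4 (n : nat) (S : {set 'Z_n}) :
  (1 < n)%N -> ~~ odd n -> distance_magic (circ S) ->
  \sum_(s in S) (-1) ^+ (- s : 'Z_n)%R != 0 :> rat -> (4 %| n)%N.
Proof.
move=> n_gt1 even_n [l [k [_ hl]]] hS.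
have psiD : {morph (fun x : 'Z_n => (-1) ^+ x : rat) : x y / x + y >-> x * y}.
  move=> x y /=; rewrite -[LHS]/((-1) ^+ nat_of_ord (x + y)%R) val_ZpD // -exprD.
  rewrite -signr_odd -[RHS]signr_odd [in RHS](divn_eq (x + y) n).
  by rewrite [in RHS]oddD oddM (negPf even_n) andbF.
have nt : (-1 : rat) ^+ (1%R : 'Z_n) != 1.
  by [].
have := magic_fourier_eq0 psiD (circ_magic_sum hl) nt hS.
rewrite (bigID (fun x : 'Z_n => odd x)) /=.
under eq_bigr => x ox do rewrite -signr_odd ox expr1 mulrN1.
under [X in _ + X]eq_bigr => x ox do rewrite -signr_odd (negPf ox) expr0 mulr1.
rewrite sumrN -!natr_sum addrC => /eqP; rewrite subr_eq0 eqr_nat => /eqP eq_sum.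
have := sum_labeling hl; rewrite card_ord.
rewrite (bigID (fun x : 'Z_n => odd x)) /= eq_sum addnn -muln2 -mulnA.
set E := (\sum_(_ | _) _)%N; rewrite Zp_cast // => eq4.
have : (4 %| n * n.+1)%N by rewrite -eq4 dvdn_mull.
by rewrite Gauss_dvdl // (@coprime_pexpl 2 2) // coprime2n /= even_n.
Qed.

Lemma primitive_char_morph (K : fieldType) (n : nat) (z : K) (j : nat) :
  (1 < n)%N -> n.-primitive_root z ->
  {morph (fun x : 'Z_n => z ^+ (j * x)) : x y / x + y >-> x * y}.
Proof.
move=> n_gt1 prz x y /=; rewrite -[LHS]/(z ^+ (j * nat_of_ord (x + y)%R)%N) val_ZpD //.
by rewrite -(prim_expr_mod prz) modnMmr (prim_expr_mod prz) mulnDr exprD.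
Qed.

(** The values of [g] are the coefficients of a polynomial of size at most [n] with the [n] distinct
    roots [z ^+ j]. *)
Lemma primitive_char_independent (K : fieldType) (n : nat) (z : K) (g : 'Z_n -> K) :
  (1 < n)%N -> n.-primitive_root z ->
  (forall j, (j < n)%N -> \sum_x g x * z ^+ (j * x) = 0) -> forall x, g x = 0.
Proof.
move=> n_gt1 prz hg x.
pose Q := \poly_(i < (Zp_trunc n).+2) g (inord i).
have rootQ : all (root Q) [seq z ^+ j | j <- iota 0 n].
  apply/allP => _ /mapP[j + ->]; rewrite mem_iota => /andP[_ ltj].
  rewrite rootE horner_poly; apply/eqP; rewrite -[RHS](hg j ltj).
  apply: eq_bigr => i _.
  by rewrite inord_val exprM.
have uniqQ : uniq [seq z ^+ j | j <- iota 0 n].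
  rewrite map_inj_in_uniq ?iota_uniq // => k l.
  rewrite !mem_iota !add0n => /andP[_ ltk] /andP[_ ltl] /eqP.
  by rewrite (eq_prim_root_expr prz) !modn_small // => /eqP.
have Q0 := roots_geq_poly_eq0 rootQ uniqQ.
have {}Q0 : Q = 0.
  by apply: Q0; rewrite size_map size_iota -[X in (_ <= X)%N](Zp_cast n_gt1) size_poly.
have := coef_poly (Zp_trunc n).+2 (fun i => g (inord i)) x.
by rewrite -/Q Q0 coef0 ltn_ord inord_val.
Qed.

(* Otherwise the labelling is invariant under translation by [n / p]. *)
Lemma magic_spectrum_not_dvd (K : numFieldType) (n p : nat) (z : K) (S : {set 'Z_n}) :
  (1 < n)%N -> n.-primitive_root z -> prime p -> (p %| n)%N ->
  distance_magic (circ S) ->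
  exists2 j, (j < n)%N /\ ~~ (p %| j)%N &
    \sum_(s in S) z ^+ (j * (- s : 'Z_n)%R) = 0.
Proof.
move=> n_gt1 prz pr_p dvd_pn [l [k [_ hl]]].
have n_gt0 := ltnW n_gt1.
case: (boolP [exists j : 'I_n, ~~ (p %| j)%N &&
    (\sum_(s in S) z ^+ (j * (- s : 'Z_n)%R) == 0)]).
  by case/existsP=> j /andP[hj /eqP sum0]; exists (j : nat).
move=> /existsPn none; exfalso.
have [h val_h] : exists h : 'Z_n, h = (n %/ p)%N :> nat.
  by exists (inZp (n %/ p)); rewrite /= Zp_cast // modn_small // ltn_Pdiv ?prime_gt1.
have h_gt0 : (0 < h)%N.
  by rewrite val_h divn_gt0 ?prime_gt0 //; apply: dvdn_leq.
have h0 : h <> 0 by move=> h0; rewrite h0 in h_gt0.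
have [l_inj _ _] := hl.
(* The transform of [g] at [j] is [(z ^+ (j * - h) - 1) * L]: the first factor vanishes when [p]
   divides [j], and [L] does otherwise. So [g = 0], against the injectivity of [l]. *)
pose g x : K := (l (x + h))%:R - (l x)%:R.
suff /(_ 0)/eqP : forall x, g x = 0.
  by rewrite /g subr_eq0 eqr_nat add0r => /eqP/l_inj/h0.
apply: (primitive_char_independent n_gt1 prz) => j ltj.
have psiD := primitive_char_morph j n_gt1 prz.
have psiNh : z ^+ (j * h) * z ^+ (j * (- h)%R) = 1.
  by rewrite -psiD subrr muln0.
under eq_bigr => x _ do rewrite /g mulrBl.
rewrite sumrB; set L := \sum_x (l x)%:R * _.
have -> : \sum_x (l (x + h))%:R * z ^+ (j * x) = z ^+ (j * (- h)%R) * L.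
  rewrite mulr_sumr [RHS](reindex_inj (addIr h)); apply: eq_bigr => x _ /=.
  by rewrite psiD mulrCA; congr (_ * _); rewrite mulrCA (mulrC (z ^+ (j * (- h)%R))) psiNh mulr1.
have [/dvdnP[q Dj]|ndv] := boolP (p %| j)%N.
  move: psiNh; rewrite val_h Dj -mulnA (mulnC p) divnK // mulnC exprM.
  by rewrite (prim_expr_order prz) expr1n mul1r => ->; rewrite mul1r subrr.
suff -> : L = 0 by rewrite mulr0 subrr.
apply: (magic_fourier_eq0 psiD (circ_magic_sum hl) (y := 1)).
  rewrite -(prim_order_dvd prz) /= Zp_cast // (modn_small n_gt1) muln1.
  by apply: contra ndv => /(dvdn_trans dvd_pn).
by have := none (Ordinal ltj); rewrite /= ndv.
Qed.

(** * Cosines and roots of unity *)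

Section Expi.
Variable R : realType.

Lemma expiD (s t : R) : expi (s + t) = expi s * expi t.
Proof. apply/eqP; rewrite eq_complex /= cosD sinD eqxx /=.
by rewrite addrC. Qed.

Lemma expi0 : expi (0 : R) = 1.
Proof. by rewrite /expi cos0 sin0. Qed.

Lemma expiMn (t : R) (k : nat) : expi (t * k%:R) = expi t ^+ k.
Proof.
elim: k => [|k IHk]; first by rewrite mulr0 expi0.
by rewrite -natr1 mulrDr mulr1 expiD IHk exprSr.
Qed.

Lemma expi_neq0 (t : R) : expi t != 0.
Proof.
have : expi t * expi (- t) = 1 by rewrite -expiD subrr expi0.
by move=> h; apply: contra_eq_neq h => ->; rewrite mul0r eq_sym oner_neq0.
Qed.

Lemma expiN (t : R) : expi (- t) = (expi t)^-1.
Proof. by rewrite -[RHS]mul1r -expi0 -(addNr t) expiD mulfK ?expi_neq0. Qed.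

Lemma expi_add_inv (t : R) : expi t + (expi t)^-1 = (2 * cos t)%:C%C.
Proof.
rewrite -expiN; apply/eqP.
by rewrite eq_complex /= cosN sinN subrr eqxx andbT mulr_natl mulr2n.
Qed.

Lemma cos_eq_expi (s t : R) : cos s = cos t -> expi s = expi t \/ expi s = (expi t)^-1.
Proof.
move=> eq_cos; have : sin s ^+ 2 == sin t ^+ 2 by rewrite !sin2cos2 eq_cos.
rewrite eqf_sqr => /orP[] /eqP eq_sin; [left|right].
  by rewrite /expi eq_cos eq_sin.
by rewrite -expiN /expi cosN sinN eq_cos eq_sin.
Qed.

Lemma expi_primitive (n : nat) : (0 < n)%N -> n.-primitive_root (expi (2 * pi / n%:R : R)).
Proof.
move=> n_gt0; have n0 : n%:R != 0 :> R by rewrite pnatr_eq0 -lt0n.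
rewrite /primitive_root_of_unity n_gt0 /=; apply/forallP => i; apply/eqP.
rewrite unity_rootE -expiMn; case: (ltngtP i.+1 n) => [lt_in| |->].
(* With [t] strictly between 0 and [pi], [cos (2 t) = 1 - 2 sin(t)^2] is less than 1. *)
- set t : R := pi * i.+1%:R / n%:R.
  have t_gt0 : 0 < sin t.
    apply: sin_gt0_pi; rewrite divr_gt0 ?mulr_gt0 ?pi_gt0 ?ltr0n //=.
    by rewrite ltr_pdivrMr ?ltr0n // ltr_pM2l ?pi_gt0 // ltr_nat.
  have -> : 2 * pi / n%:R * i.+1%:R = t *+ 2 by rewrite /t mulr2n; field.
  apply/negbTE/eqP => -[] /eqP; rewrite cos_mulr2n cos2sin2 => + _.
  by rewrite -subr_eq0 => /eqP h; have := exprn_gt0 2 t_gt0; lra.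
- by rewrite ltnNge ltn_ord.
rewrite mulfVK // mulrC -[pi * 2]/(pi * (1 + 1)) mulrDr mulr1 -mulr2n.
by rewrite /expi cos2pi sin2pi eqxx.
Qed.

Lemma cos_eq_dvdn (n x y : nat) : (0 < n)%N ->
  cos (2 * pi * x%:R / n%:R : R) = cos (2 * pi * y%:R / n%:R) ->
  (x == y %[mod n])%N || (n %| x + y)%N.
Proof.
move=> n_gt0; have prz := expi_primitive n_gt0.
rewrite -!mulrA ![_%:R / _]mulrC !mulrA => /cos_eq_expi.
rewrite !expiMn; case=> [/eqP|h].
  by rewrite (eq_prim_root_expr prz) => ->.
apply/orP; right; rewrite (prim_order_dvd prz) exprD h mulVf //.
by rewrite expf_neq0 ?expi_neq0.
Qed.

End Expi.

(** * Rearrangements, ratios and the three types *)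

(** Used to lift the sorting of the ratios to a rearrangement of [a], [b], [c] themselves. *)
Lemma perm_eq_map_inv (T T' : eqType) (f : T -> T') (s : seq T') (t : seq T) :
  perm_eq s (map f t) -> exists2 u, perm_eq t u & s = map f u.
Proof.
elim: s t => [|y s IHs] t.
  by rewrite perm_sym => /perm_nilP; case: t => // _; exists [::].
move=> st; have /mapP[x xt Dy] : y \in map f t by rewrite -(perm_mem st) mem_head.
have tx := perm_to_rem xt.
have [u pu Ds] : exists2 u, perm_eq (rem x t) u & s = map f u.
  apply: IHs; rewrite -(perm_cons y) (perm_trans st) // Dy.
  exact: (perm_map f tx).
exists (x :: u); last by rewrite /= -Ds Dy.
by rewrite (perm_trans tx) // perm_cons.
Qed.

Lemma perm_eq2P (T : eqType) (x1 x2 y1 y2 : T) :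
  perm_eq [:: x1; x2] [:: y1; y2] -> (x1 = y1 /\ x2 = y2) \/ (x1 = y2 /\ x2 = y1).
Proof.
move=> pxy; have := perm_mem pxy x1; rewrite !inE eqxx => /esym/orP[] /eqP Dx1.
  move: pxy; rewrite Dx1 perm_cons => /(@perm_small_eq _ [:: x2] [:: y2] isT)[->]; by left.
move: (perm_trans pxy (permEl (perm_catC [:: y1] [:: y2]))); rewrite Dx1 /= perm_cons.
by move/(@perm_small_eq _ [:: x2] [:: y1] isT) => [->]; right.
Qed.

Lemma perm_eq3P (T : eqType) (P : T -> T -> T -> Prop) (x1 x2 x3 y1 y2 y3 : T) :
  P y1 y2 y3 -> P y1 y3 y2 -> P y2 y1 y3 -> P y2 y3 y1 -> P y3 y1 y2 -> P y3 y2 y1 ->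
  perm_eq [:: x1; x2; x3] [:: y1; y2; y3] -> P x1 x2 x3.
Proof.
move=> ? ? ? ? ? ? pxy.
have := perm_mem pxy x1; rewrite !inE eqxx => /esym/or3P[] /eqP Dx1.
- by move: pxy; rewrite Dx1 perm_cons => /perm_eq2P[] [-> ->].
- move: (perm_trans pxy (permEl (perm_catCA [:: y1] [:: y2] [:: y3]))).
  by rewrite Dx1 /= perm_cons => /perm_eq2P[] [-> ->].
move: (perm_trans pxy (permEl (perm_catC [:: y1; y2] [:: y3]))).
by rewrite Dx1 /= perm_cons => /perm_eq2P[] [-> ->].
Qed.

Section Ratios.
Variables (R : realType) (n : nat).
Implicit Types (j : 'I_n) (s a b c : 'Z_n).

(** Folding the angle into [[0, pi]] with [acos] gives the only number allowed by [is_ratio], so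
    ratios become a function of [s]. *)
Definition ratio j s : R := acos (cos (angle R j s)) / pi.

Lemma is_ratioE j s (r : R) : is_ratio j s r <-> r = ratio j s.
Proof.
have pi0 : (pi : R) != 0 by rewrite lt0r_neq0 ?pi_gt0.
have cos_int : -1 <= cos (angle R j s) <= 1 by rewrite cos_geN1 cos_le1.
rewrite /ratio; split=> [[r01 <-]|->].
  rewrite cosK; first by rewrite mulrAC divff // mul1r.
  have /andP[r0 r1] := r01.
  by rewrite in_itv /=; apply/andP; rewrite mulr_ge0 ?pi_ge0 // ger_pMr ?pi_gt0.
split; last by rewrite /ratio mulrC mulfVK // acosK.
by rewrite divr_ge0 ?acos_ge0 ?pi_ge0 //= ler_pdivrMr ?pi_gt0 // mul1r acos_lepi.
Qed.

Lemma sorted_ratiosE a b c j (r1 r2 r3 : R) :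
  sorted_ratios a b c j r1 r2 r3 <->
  perm_eq [:: r1; r2; r3] (map (ratio j) [:: a; b; c]) /\ r1 <= r2 <= r3.
Proof.
split=> [[ra [rb [rc [/is_ratioE -> /is_ratioE -> /is_ratioE -> //]]]]|[pr le_r]].
by exists (ratio j a), (ratio j b), (ratio j c); split=> //; apply/is_ratioE.
Qed.

Lemma sorted_ratios_perm a b c a' b' c' j (r1 r2 r3 : R) :
  perm_eq [:: a; b; c] [:: a'; b'; c'] ->
  sorted_ratios a b c j r1 r2 r3 <-> sorted_ratios a' b' c' j r1 r2 r3.
Proof.
move=> abc; rewrite !sorted_ratiosE.
by have /permPr -> := perm_map (ratio j) abc.
Qed.

Lemma sorted_ratios_ex a b c j (r1 r2 r3 : R) :
  sorted_ratios a b c j r1 r2 r3 ->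
  exists a' b' c', perm_eq [:: a; b; c] [:: a'; b'; c'] /\
    [/\ is_ratio j a' r1, is_ratio j b' r2 & is_ratio j c' r3].
Proof.
rewrite sorted_ratiosE => -[/perm_eq_map_inv[[|a' [|b' [|c' [|]]]] pu] //= [-> -> ->] _].
by exists a', b', c'; split=> //; split; apply/is_ratioE.
Qed.

Lemma pm3_perm a b c a' b' c' :
  perm_eq [:: a; b; c] [:: a'; b'; c'] -> pm3 a b c = pm3 a' b' c'.
Proof.
move=> /perm_mem abc.
have pm3E (u v w x : 'Z_n) : (x \in pm3 u v w) = has (fun s => (x == s) || (x == - s)) [:: u; v; w].
  by rewrite !inE /= orbF -!orbA.
by apply/setP => x; rewrite !pm3E; apply: eq_has_r.
Qed.

Lemma sum_pm3 (V : zmodType) (F : 'Z_n -> V) a b c : #|pm3 a b c| = 6%N ->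
  \sum_(s in pm3 a b c) F s = F a + F (- a) + (F b + F (- b)) + (F c + F (- c)).
Proof.
have eq_mem : pm3 a b c =i [:: a; - a; b; - b; c; - c] by move=> s; rewrite !inE -!orbA.
rewrite (eq_card eq_mem) => card6.
have uniq_s : uniq [:: a; - a; b; - b; c; - c] by apply/card_uniqP.
by rewrite (eq_bigl _ _ eq_mem) -big_uniq //= !big_cons big_nil addr0 !addrA.
Qed.

Local Notation z := (expi (2 * pi / n%:R : R)).

Lemma chiE j s : chi R j s = z ^+ j ^+ s.
Proof. by rewrite /chi /angle -mulrA [_%:R / _]mulrC mulrA expiMn exprM. Qed.

Lemma chi_sum_pm3 a b c j : (1 < n)%N -> #|pm3 a b c| = 6%N ->
  chi_sum R j (pm3 a b c) = z ^+ j ^+ a + (z ^+ j ^+ a)^-1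
    + (z ^+ j ^+ b + (z ^+ j ^+ b)^-1) + (z ^+ j ^+ c + (z ^+ j ^+ c)^-1).
Proof.
move=> n_gt1 card6; have prz := expi_primitive R (ltnW n_gt1).
have zN s : z ^+ j ^+ (- s : 'Z_n)%R = (z ^+ j ^+ s)^-1.
  have : z ^+ (j * s) * z ^+ (j * (- s : 'Z_n)%R) = 1.
    by rewrite -(primitive_char_morph j n_gt1 prz) subrr muln0.
  rewrite !exprM => h; have zs0 : z ^+ j ^+ s != 0 by rewrite !expf_neq0 ?expi_neq0.
  by apply: (mulfI zs0); rewrite mulfV.
by rewrite /chi_sum (sum_pm3 _ card6) !chiE !zN.
Qed.

Lemma is_ratio_cos0 j s (r : R) : is_ratio j s r -> cos (pi * r) = 0 ->
  z ^+ j ^+ s ^+ 2 = -1.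
Proof.
case=> _ -> cos0; apply/eqP; rewrite -chiE -addrV_eq0 ?expi_neq0 //.
by rewrite expi_add_inv cos0 mulr0.
Qed.

Lemma is_ratio_expi j s (r : R) : is_ratio j s r ->
  expi (pi * r) = z ^+ j ^+ s \/ expi (pi * r) = (z ^+ j ^+ s)^-1.
Proof. by case=> _ /cos_eq_expi; rewrite -chiE. Qed.

(* The ratios occurring in type 3 are multiples of 1/15. *)
Lemma is_ratio_dvdn j s (v : nat) : (1 < n)%N -> is_ratio j s (v%:R / 15 : R) ->
  (30 * (j * s) == n * v %[mod 30 * n])%N || (30 * n %| 30 * (j * s) + n * v)%N.
Proof.
move=> n_gt1 [_ eq_cos]; have n0 : n%:R != 0 :> R by rewrite pnatr_eq0 -lt0n ltnW.
(* Both angles are written over the common denominator [30 * n]: [pi * v / 15] is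
   [2 * pi * (n * v) / (30 * n)]. *)
apply: (@cos_eq_dvdn R); first by rewrite muln_gt0 (ltnW n_gt1).
rewrite [RHS](_ : _ = cos (pi * (v%:R / 15 : R))).
  by rewrite eq_cos /angle !natrM; congr cos; field.
by rewrite !natrM; congr cos; field.
Qed.

(** The element with the middle ratio 1/2 has cosine 0 and is put first; the outer two have opposite
    cosines, hence angles that agree up to sign after adding [pi]. *)
Lemma type1_expr a b c j : type1 R a b c j ->
  exists a' b' c', perm_eq [:: a; b; c] [:: a'; b'; c'] /\
    z ^+ j ^+ a' ^+ 2 = -1 /\
    (z ^+ j ^+ b' = - z ^+ j ^+ c' \/ z ^+ j ^+ b' = - (z ^+ j ^+ c')^-1).
Proof.
case=> r1 [r2 [r3 [/sorted_ratios_ex[a' [b' [c' [pu [ha hb hc]]]]]]]] [_ Dr2 Dr3].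
exists b', a', c'; split; last split.
- exact: perm_trans pu (permEl (perm_catCA [:: a'] [:: b'] [:: c'])).
- by apply: is_ratio_cos0 hb _; rewrite Dr2 mul1r cos_pihalf.
have : cos (angle R j a') = cos (angle R j c' + pi).
  by case: ha hc => _ <- [_ hc]; rewrite cosDpi -hc Dr3 mulrBr mulr1 addrC cosDpi cosN opprK.
have expi_pi : expi pi = -1 :> R[i].
  by apply/eqP; rewrite eq_complex /= cospi sinpi oppr0 !eqxx.
move/cos_eq_expi; rewrite expiD -!/(chi R _ _) !chiE expi_pi mulrN1.
by rewrite invrN.
Qed.

(** The cosine at [a] is 0 and those at [b] and [c] are opposite. Exchanging [b] and [c] if
    necessary, the one at [b] is nonnegative, so the ratio of [b] is at most 1/2 and comes first. *)
Lemma type1_of_expr a b c j : z ^+ j ^+ a ^+ 2 = -1 ->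
  z ^+ j ^+ b + (z ^+ j ^+ b)^-1 + (z ^+ j ^+ c + (z ^+ j ^+ c)^-1) = 0 ->
  type1 R a b c j.
Proof.
move=> /eqP; rewrite -addrV_eq0 ?expf_neq0 ?expi_neq0 //.
rewrite -!chiE !expi_add_inv => /eqP ha hbc.
have {ha} cosa : cos (angle R j a) = 0.
  by move/(congr1 (@complex.Re R)): ha => /= h; lra.
have cosc : cos (angle R j c) = - cos (angle R j b).
  move/(congr1 (@complex.Re R)): hbc => /= h; lra.
wlog cosb : b c cosc {hbc} / 0 <= cos (angle R j b).
  move=> wl; have [|lt0] := leP 0 (cos (angle R j b)); first exact: wl.
  have cosb : cos (angle R j b) = - cos (angle R j c) by rewrite cosc opprK.
  have posc : 0 <= cos (angle R j c) by rewrite cosc oppr_ge0 ltW.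
  have [r1 [r2 [r3 [h1 h2]]]] := wl c b cosb posc.
  exists r1, r2, r3; split=> //; apply: (sorted_ratios_perm _ _ _ _ _).1 h1.
  by rewrite perm_cons (perm_catC [:: c] [:: b]).
have pi0 : (pi : R) != 0 by rewrite lt0r_neq0 ?pi_gt0.
have cos_int : -1 <= cos (angle R j b) <= 1 by rewrite cos_geN1 cos_le1.
have rb : 0 <= ratio j b <= 1 / 2.
  rewrite /ratio divr_ge0 ?acos_ge0 ?pi_ge0 //= ler_pdivrMr ?pi_gt0 //.
  rewrite leNgt; apply/negP => half_lt.
  have half_in : pi / 2 \in `[0, (pi : R)].
    by rewrite in_itv /=; apply/andP; have := pi_gt0 R; split; lra.
  have acos_in : acos (cos (angle R j b)) \in `[0, (pi : R)].
    by rewrite in_itv /= acos_ge0 // acos_lepi.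
  have := ltr_cos half_in acos_in.
  rewrite acosK // cos_pihalf ltNge cosb; move: half_lt.
  by rewrite mul1r mulrC => ->.
exists (ratio j b), (1 / 2), (1 - ratio j b); split; last by [].
apply/sorted_ratiosE; split; last by lra.
have -> : 1 / 2 = ratio j a.
  by rewrite /ratio cosa acos0 mulrAC divff.
have -> : 1 - ratio j b = ratio j c.
  by rewrite /ratio cosc acosN // mulrBl divff.
exact: permEl (perm_catCA [:: _] [:: _] [:: _]).
Qed.

Lemma expi_pi_third_neq1 (k : nat) : ~~ (3 %| k)%N -> expi (pi * (2 * k%:R / 3)) <> 1 :> R[i].
Proof.
move=> k3; have -> : pi * (2 * k%:R / 3) = 2 * pi / 3 * k%:R :> R by field.
by rewrite expiMn => /eqP; rewrite -(prim_order_dvd (expi_primitive R _)) ?(negPf k3).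
Qed.

Lemma expi_pi_third_cube (k : nat) : expi (pi * (2 * k%:R / 3)) ^+ 3 = 1 :> R[i].
Proof.
have -> : pi * (2 * k%:R / 3) = 2 * pi / 3 * k%:R :> R by field.
by rewrite expiMn exprAC (prim_expr_order (expi_primitive R _)) ?expr1n.
Qed.

(** Up to complex conjugation of each, the two unit numbers are distinct vertices of one equilateral
    triangle inscribed in the unit circle. *)
Definition triangle (r s : R) : Prop := exists e1 e2 : R[i],
  [/\ e1 = expi (pi * r) \/ e1 = (expi (pi * r))^-1,
    e2 = expi (pi * s) \/ e2 = (expi (pi * s))^-1, e1 ^+ 3 = e2 ^+ 3 & e1 <> e2].

Lemma triangle_sym (r s : R) : triangle r s -> triangle s r.
Proof. by case=> e1 [e2 [h1 h2 h3 h4]]; exists e2, e1; split=> // /esym. Qed.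

(** The quotient of [expi (pi * r)] and the inverse of [expi (pi * s)] is a nontrivial cube root of
    unity. *)
Lemma triangleD (r s : R) (k : nat) : ~~ (3 %| k)%N -> r + s = 2 * k%:R / 3 -> triangle r s.
Proof.
move=> k3 rs; exists (expi (pi * r)), (expi (pi * s))^-1.
have De : expi (pi * r) = expi (pi * (2 * k%:R / 3)) * (expi (pi * s))^-1.
  by rewrite -rs mulrDr expiD mulfK ?expi_neq0.
split; [by left|by right| |].
  by rewrite De exprMn expi_pi_third_cube mul1r.
rewrite De => /eqP; rewrite -subr_eq0 -{2}[(expi (pi * s))^-1]mul1r -mulrBl mulf_eq0 subr_eq0.
by rewrite invr_eq0 (negPf (expi_neq0 _)) orbF => /eqP/(expi_pi_third_neq1 k3).
Qed.

Lemma triangleB (r s : R) (k : nat) : ~~ (3 %| k)%N -> s - r = 2 * k%:R / 3 -> triangle r s.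
Proof.
move=> k3 rs; have [||e1 [e2 [h1 h2 h3 h4]]] := @triangleD (- r) s k; rewrite ?[- r + s]addrC //.
exists e1, e2; split=> //; move: h1; rewrite mulrN expiN invrK.
by case; [right|left].
Qed.

Lemma type2_expr a b c j : type2 R a b c j ->
  exists e1 e2 : R[i], [/\ e1 = z ^+ j ^+ b \/ e1 = (z ^+ j ^+ b)^-1,
    e2 = z ^+ j ^+ c \/ e2 = (z ^+ j ^+ c)^-1, e1 ^+ 3 = e2 ^+ 3 & e1 <> e2].
Proof.
case=> r1 [r2 [r3 [/sorted_ratiosE[pr _]]]] [_ Dr2 Dr3].
(* Since [r1 + r2 = 2/3], [r3 - r1 = 2/3] and [r2 + r3 = 4/3], any two of the ratios form a
   triangle, so it does not matter which ones belong to [b] and [c]. *)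
have t12 : triangle r1 r2 by apply: (@triangleD _ _ 1) => //; rewrite Dr2; field.
have t13 : triangle r1 r3 by apply: (@triangleB _ _ 1) => //; rewrite Dr3; field.
have t23 : triangle r2 r3 by apply: (@triangleD _ _ 2) => //; rewrite Dr2 Dr3; field.
have [e1 [e2 [h1 h2 h3 h4]]] : triangle (ratio j b) (ratio j c).
  move: pr; rewrite perm_sym /=.
  by apply: (@perm_eq3P _ (fun _ => triangle)) => //; apply: triangle_sym.
have sgn s e : e = expi (pi * ratio j s) \/ e = (expi (pi * ratio j s))^-1 ->
    e = z ^+ j ^+ s \/ e = (z ^+ j ^+ s)^-1.
  have /is_ratio_expi[] : is_ratio j s (ratio j s) by apply/is_ratioE.
    by move=> ->.
  by move=> ->; rewrite invrK => -[]; [right|left].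
by exists e1, e2; split=> //; apply: sgn.
Qed.

End Ratios.

(** * Circulants with a type 3 zero *)

(** The [x] with [n %| N * x] form a subgroup; containing the generators, it contains 1. *)
Lemma generated_dvdn (n N : nat) (a b c : 'Z_n) : (1 < n)%N ->
  <<pm3 a b c>>%g = [set: 'Z_n] ->
  (n %| N * a)%N -> (n %| N * b)%N -> (n %| N * c)%N -> (n %| N)%N.
Proof.
move=> n_gt1 gen na nb nc.
pose H := [set x : 'Z_n | n %| N * x]%N.
have gH : group_set H.
  apply/group_setP; split=> [|x y]; first by rewrite inE /= muln0.
  rewrite !inE => nx ny.
  by rewrite -[(x * y)%g]/(x + y)%R val_ZpD // /dvdn modnMmr mulnDr -/(dvdn _ _) dvdn_add.
have dN (x : 'Z_n) : (n %| N * x)%N -> (n %| N * (- x)%R)%N.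
  move=> nx; rewrite val_ZpN // /dvdn modnMmr mulnBr.
  exact: dvdn_sub (dvdn_mull _ (dvdnn n)) nx.
have : <<pm3 a b c>>%g \subset group gH.
  rewrite gen_subG; apply/subsetP => x; rewrite !inE -!orbA.
  by case/or4P=> [|||/or3P[]] /eqP ->; rewrite ?dN.
rewrite gen => /subsetP/(_ 1%R); rewrite !inE => /(_ isT).
by rewrite -[nat_of_ord _]/1%N muln1.
Qed.

(** Divisibility by [n] can be tested with a cofactor [e] depending on the prime: with
    [g = gcdn n M], [n / g] divides [e], and a prime factor [p] of [n / g] contradicts the choice of
    [e]. *)
Lemma dvdn_local (n M : nat) : (0 < n)%N ->
  (forall p, prime p -> (p %| n)%N -> exists2 e, ~~ (p %| e)%N & (n %| e * M)%N) ->
  (n %| M)%N.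
Proof.
move=> n_gt0 loc; pose g := gcdn n M.
have g_gt0 : (0 < g)%N by rewrite gcdn_gt0 n_gt0.
have Dn : (n %/ g * g = n)%N by rewrite divnK ?dvdn_gcdl.
have [le1|gt1] := leqP (n %/ g) 1.
  suff -> : n = g by exact: dvdn_gcdr.
  by case: (n %/ g)%N le1 Dn n_gt0 => [|[]] // _ <-; rewrite ?mul0n ?mul1n.
have p_ng : (pdiv (n %/ g) %| n %/ g)%N := pdiv_dvd _.
have pn : (pdiv (n %/ g) %| n)%N by rewrite -[X in (_ %| X)%N]Dn dvdn_mulr.
have [e pe ne] := loc _ (pdiv_prime gt1) pn; exfalso; apply: (negP pe).
have [u Du] := dvdnP (dvdn_gcdr n M : g %| M)%N.
have cop : coprime (n %/ g) u.
  have : gcdn (n %/ g * g) (u * g) == g by rewrite Dn -Du.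
  by rewrite -muln_gcdl -[X in _ == X]mul1n eqn_pmul2r.
apply: dvdn_trans p_ng _.
by move: ne; rewrite Du mulnA -{1}Dn dvdn_pmul2r // Gauss_dvdl.
Qed.

(* [a] is the element of the connection set divisible by 5: for a type 3 zero
   [k * (n / 30)] the residues of [k * a], [k * b], [k * c] modulo 30 are, up to
   sign, 10, 3, 9 or 5, 6, 12. *)
Definition type3_residues (a b c : nat) : Prop :=
  [/\ [/\ 5 %| a, ~~ (5 %| b), ~~ (5 %| c), b != c %[mod 5] & ~~ (5 %| b + c)],
      [/\ ~~ (3 %| a), 3 %| b & 3 %| c] & odd (a + b) /\ odd (a + c)]%N.

Section Core.

Variables (R : realType) (n : nat) (a b c : 'Z_n).
Hypotheses (n_gt1 : (1 < n)%N) (card6 : #|pm3 a b c| = 6%N).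
Hypothesis gen : <<pm3 a b c>>%g = [set: 'Z_n].
Hypothesis magic : distance_magic (circ (pm3 a b c)).
Hypothesis n30 : (30 %| n)%N.
Hypothesis res : type3_residues a b c.

Let a5 : (5 %| a)%N. Proof. by case: res => -[]. Qed.
Let b5 : ~~ (5 %| b)%N. Proof. by case: res => -[]. Qed.
Let c5 : ~~ (5 %| c)%N. Proof. by case: res => -[]. Qed.
Let bc5 : (b != c %[mod 5])%N. Proof. by case: res => -[]. Qed.
Let bc5' : ~~ (5 %| b + c)%N. Proof. by case: res => -[]. Qed.
Let a3 : ~~ (3 %| a)%N. Proof. by case: res => _ []. Qed.
Let b3 : (3 %| b)%N. Proof. by case: res => _ []. Qed.
Let c3 : (3 %| c)%N. Proof. by case: res => _ []. Qed.
Let oab : odd (a + b). Proof. by case: res => _ _ []. Qed.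
Let oac : odd (a + c). Proof. by case: res => _ _ []. Qed.

Local Notation S := (pm3 a b c).
Local Notation z := (expi (2 * pi / n%:R : R)).

Let n_gt0 : (0 < n)%N := ltnW n_gt1.
Let prz : n.-primitive_root z := expi_primitive R n_gt0.
Let le_n (s : 'Z_n) : (s <= n)%N := ltnW (ltn_Zp s n_gt1).

Let dvd_n d : (d %| 30)%N -> (d %| n)%N.
Proof. by move=> h; apply: dvdn_trans n30. Qed.

Let zj_neq0 (j s : nat) : z ^+ j ^+ s != 0.
Proof. by rewrite !expf_neq0 ?expi_neq0. Qed.

Let zjn (j : nat) : z ^+ j ^+ n = 1.
Proof. by rewrite exprAC (prim_expr_order prz) expr1n. Qed.

Let zeroE (j : 'I_n) : (j \in chi_zeros R S) =
  (z ^+ j ^+ a + (z ^+ j ^+ a)^-1 + (z ^+ j ^+ b + (z ^+ j ^+ b)^-1)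
    + (z ^+ j ^+ c + (z ^+ j ^+ c)^-1) == 0).
Proof. by rewrite inE chi_sum_pm3. Qed.

Lemma zeros_not_dvdn (p : nat) : prime p -> (p %| n)%N ->
  exists2 j, j \in chi_zeros R S & ~~ (p %| j)%N.
Proof.
move=> pr_p pn; have [j [ltj pj] sum0] := magic_spectrum_not_dvd n_gt1 prz pr_p pn magic.
exists (Ordinal ltj) => //; rewrite inE /chi_sum; apply/eqP; move: sum0.
rewrite !sum_pm3 // !opprK => <-.
by rewrite !chiE -!exprM /= [X in X + _ + _]addrC [X in _ + X + _]addrC [X in _ + _ + X]addrC.
Qed.

(** The alternating character sums over the connection set to twice a sum of three signs, which is
    not zero. *)
Lemma core_dvd4 : (4 %| n)%N.
Proof.
have n_even : ~~ odd n by rewrite -dvdn2 dvd_n.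
apply: (magic_even_order_dvd4 n_gt1 n_even magic); rewrite sum_pm3 //.
have sgnN (s : 'Z_n) : (-1) ^+ (- s : 'Z_n)%R = (-1) ^+ s :> rat.
  rewrite val_ZpN // -signr_odd -[RHS]signr_odd; congr (_ ^+ (nat_of_bool _)).
  have := divn_eq (n - s) n => /(congr1 odd); rewrite oddB // oddD oddM (negPf n_even) andbF.
  by [].
rewrite !opprK !sgnN -!(signr_odd _ (nat_of_ord _)).
by case: (odd a); case: (odd b); case: (odd c).
Qed.

(** Modulo 3, [a] is alone in its class, because [b] and [c] are divisible by 3. *)
Lemma core_not_dvd9 : ~~ (9 %| n)%N.
Proof.
apply/negP => n9; have [j] := zeros_not_dvdn (isT : prime 3) (@dvd_n 3 isT).
rewrite zeroE => /eqP sum0 j3.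
apply: (class_not_isolated n_gt0 prz (isT : prime 3) (@dvd_n 3 isT) j3 _
  (le_n a) (le_n b) (le_n c) sum0); first by rewrite n9.
all: lia.
Qed.

(** Modulo 5, [b] is alone in its class. *)
Lemma core_not_dvd25 : ~~ (25 %| n)%N.
Proof.
apply/negP => n25; have [j] := zeros_not_dvdn (isT : prime 5) (@dvd_n 5 isT).
rewrite zeroE [X in X + _]addrC => /eqP sum0 j5.
apply: (class_not_isolated n_gt0 prz (isT : prime 5) (@dvd_n 5 isT) j5 _
  (le_n b) (le_n a) (le_n c) sum0); first by rewrite n25.
all: lia.
Qed.

(** Modulo 2 the class of [a] is the pair of [a] and [- a], and [4 %| n] makes the class relations
    available. *)
Lemma zero_odd (j : 'I_n) : j \in chi_zeros R S -> odd j ->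
  z ^+ j ^+ a ^+ 2 = -1 /\
  z ^+ j ^+ b + (z ^+ j ^+ b)^-1 + (z ^+ j ^+ c + (z ^+ j ^+ c)^-1) = 0.
Proof.
rewrite zeroE => /eqP sum0 oj; have n4 := core_dvd4.
have ab2 : ((a + b) %% 2 = 1)%N by rewrite modn2 oab.
have ac2 : ((a + c) %% 2 = 1)%N by rewrite modn2 oac.
have x0 : z ^+ j ^+ a + (z ^+ j ^+ a)^-1 = 0.
  apply: (class_pair n_gt0 prz (isT : prime 2) (@dvd_n 2 isT) _ _
    (le_n a) (le_n b) (le_n c) sum0);
    by [rewrite dvdn2 oj | rewrite n4 | lia].
split; first by apply/eqP; rewrite -addrV_eq0 ?x0.
by rewrite -[RHS]sum0 x0 add0r.
Qed.

Lemma core_type1_ex : exists2 j, j \in chi_zeros R S & type1 R a b c j.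
Proof.
have [j jA] := zeros_not_dvdn (isT : prime 2) (@dvd_n 2 isT).
rewrite dvdn2 negbK => oj; exists j => //.
by have [] := zero_odd jA oj; apply: type1_of_expr.
Qed.

Lemma core_expr_a_dvdn (j : nat) : z ^+ j ^+ a ^+ 2 = -1 -> (n %| j * (4 * a))%N.
Proof.
move=> x2; rewrite (prim_order_dvd prz) exprM (mulnC 4) (exprM _ a) (exprM _ 2 2) x2.
by rewrite sqrrN expr1n.
Qed.

(** For [p] other than 3 and 5 the local cofactor is a zero [j] prime to [p], at which [z ^+ j ^+ a]
    is a square root of -1. For [p] = 3 or 5 it is [n / p], which [p] does not divide. *)
Lemma core_dvd12a : (n %| 12 * a)%N.
Proof.
have [n9 n25] := (core_not_dvd9, core_not_dvd25).
apply: dvdn_local => // p pr_p pn.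
have [j jA pj] := zeros_not_dvdn pr_p pn.
have of_x2 : z ^+ j ^+ a ^+ 2 = -1 -> exists2 e, ~~ (p %| e)%N & (n %| e * (12 * a))%N.
  move=> /core_expr_a_dvdn nj; exists (j : nat) => //.
  by rewrite (_ : 12 * a = 3 * (4 * a))%N ?mulnA // -!mulnA mulnCA dvdn_mull.
have [p6|p6] := leqP 7 p.
  apply: of_x2; have sum0 := eqP (etrans (esym (zeroE j)) jA).
  apply: (class_sum_large_prime n_gt0 prz pr_p pn pj p6 (le_n a) (le_n b) (le_n c) sum0) => //.
    (* A prime dividing [a], [b] and [c] would make [n] divide [n %/ p], as they generate. *)
    apply/negP => /and3P[pa pb pc].
    have dv t : (p %| t)%N -> (n %| n %/ p * t)%N.
      by case/dvdnP=> q ->; rewrite mulnCA divnK // dvdn_mull.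
    have := generated_dvdn n_gt1 gen (dv _ pa) (dv _ pb) (dv _ pc).
    by rewrite gtnNdvd // ?ltn_Pdiv ?prime_gt1 // divn_gt0 ?prime_gt0 // dvdn_leq.
  exact: (@dvd_n 3 isT).
have [p2|p_odd] := eqVneq p 2%N.
  apply: of_x2; have oj : odd j by rewrite -[odd j]negbK -dvdn2 -p2.
  by have [] := zero_odd jA oj.
have p35 : p = 3%N \/ p = 5%N.
  by move: pr_p p6 p_odd; case: (p) => [|[|[|[|[|[|[|q]]]]]]] //; [left|right].
exists (n %/ p)%N.
  have -> : (p %| n %/ p)%N = (p * p %| n)%N.
    by rewrite -[in RHS](divnK pn) dvdn_pmul2r ?prime_gt0.
  by case: p35 => ->.
have : (p %| 12 * a)%N by case: p35 => ->; [apply: dvdn_mulr|apply: dvdn_mull].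
by case/dvdnP=> q ->; rewrite mulnCA divnK // dvdn_mull.
Qed.

Lemma core_expr_a_ndvdn (j : nat) : z ^+ j ^+ a ^+ 2 = -1 -> ~~ (n %| j * (6 * a))%N.
Proof.
move=> x2; rewrite (prim_order_dvd prz) exprM (mulnC 6) (exprM _ a) (exprM _ 2 3) x2.
by rewrite -signr_odd expr1 -subr_eq0 -opprD oppr_eq0 -(natrD _ 1 1) pnatr_eq0.
Qed.

Lemma core_expr_a_odd (j : nat) : z ^+ j ^+ a ^+ 2 = -1 -> odd j.
Proof.
move/core_expr_a_ndvdn; apply: contraR => /negbTE j_even.
rewrite -[j]odd_double_half j_even add0n -muln2.
rewrite (_ : j./2 * 2 * (6 * a) = j./2 * (12 * a))%N; last by lia.
by rewrite dvdn_mull ?core_dvd12a.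
Qed.

(** The bound [q < 12] comes from [a < n]. If 3 divided [q], then 3 would divide [4 * a]; if [q]
    were even, [n] would divide [6 * a], whereas the sixth power of a square root of -1 is -1. *)
Lemma core_12a_cofactor : exists2 q, (12 * a = q * n)%N & q \in [:: 1; 5; 7; 11]%N.
Proof.
have [q Dq] := dvdnP core_dvd12a; exists q => //.
have n9 := core_not_dvd9; have n3 := @dvd_n 3 isT.
have lt_an := ltn_Zp a n_gt1.
have q12 : (q < 12)%N by rewrite -(ltn_pmul2r n_gt0) -Dq ltn_pmul2l.
have q3 : ~~ (3 %| q)%N.
  apply: contra a3 => /dvdnP[q' Dq']; have {}Dq : (4 * a = q' * n)%N by lia.
  by rewrite -(@Gauss_dvdr 3 4) // Dq dvdn_mull.
have q2 : odd q.
  have [j jA j2] := zeros_not_dvdn (isT : prime 2) (@dvd_n 2 isT).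
  have oj : odd j by rewrite -[odd j]negbK -dvdn2.
  have [/core_expr_a_ndvdn + _] := zero_odd jA oj.
  apply: contraR => /negbTE q_even.
  have -> : (6 * a = q./2 * n)%N.
    have := odd_double_half q; rewrite q_even; move: (q./2) Dq => h Dq Dh.
    by apply: (@eqP _ _ _); rewrite -(@eqn_pmul2l 2) // mulnA Dq -Dh add0n -mul2n mulnA.
  by rewrite dvdn_mull ?dvdn_mull.
by move: q12 q3 q2 {Dq}; do 12![case: q => [|q] //].
Qed.

(** By parity the square root of -1 can only occur at [a]. Then [n %| j * (4 * a)] gives [3 %| j].
    Squaring the relation between [b] and [c] shows that [n] divides [2 * j] times their sum or
    difference, neither of which is divisible by 5. *)
Lemma core_type1 (j : 'I_n) : type1 R a b c j -> odd j /\ (15 %| j)%N.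
Proof.
have [n3 n5] := (@dvd_n 3 isT, @dvd_n 5 isT).
case/type1_expr=> a' [b' [c' [pu [hx2 hyw]]]].
have [x2 yw] : z ^+ j ^+ a ^+ 2 = -1 /\
    (z ^+ j ^+ b = - z ^+ j ^+ c \/ z ^+ j ^+ b = - (z ^+ j ^+ c)^-1).
  move: hx2 hyw; move: pu; rewrite perm_sym.
  pose P (x y w : 'Z_n) := z ^+ j ^+ x ^+ 2 = -1 ->
    (z ^+ j ^+ y = - z ^+ j ^+ w \/ z ^+ j ^+ y = - (z ^+ j ^+ w)^-1) ->
     z ^+ j ^+ a ^+ 2 = -1 /\
    (z ^+ j ^+ b = - z ^+ j ^+ c \/ z ^+ j ^+ b = - (z ^+ j ^+ c)^-1).
  have sym (u v : R[i]) : u = - v \/ u = - v^-1 -> v = - u \/ v = - u^-1.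
    by case=> ->; rewrite ?opprK ?invrN ?invrK ?opprK; [left|right].
  apply: (@perm_eq3P _ P); rewrite /P => //.
  - by move=> ? /sym.
  - by move=> h /(root_parity_contra oac h).
  - by move=> h /sym/(root_parity_contra oac h).
  - by move=> h /(root_parity_contra oab h).
  - by move=> h /sym/(root_parity_contra oab h).
split; first exact: core_expr_a_odd x2.
rewrite (@Gauss_dvd 3 5) //; apply/andP; split.
  have : (3 %| j * (4 * a))%N by rewrite (dvdn_trans n3) ?core_expr_a_dvdn.
  by rewrite !Euclid_dvdM // (negPf a3) !orbF.
have {yw} : (n %| 2 * (j * (b + c)) )%N \/ (j * b * 2 = j * c * 2 %[mod n])%N.
  case: yw => /(congr1 (fun t => t ^+ 2)); rewrite sqrrN ?exprVn => e; [right|left].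
    by apply/eqP; rewrite -(eq_prim_root_expr prz) !exprM e.
  rewrite (prim_order_dvd prz) mulnC exprM mulnDr exprD !exprM exprMn e mulVf //.
  by rewrite expf_neq0.
case=> [/(dvdn_trans n5)|/eqP e].
  by rewrite !Euclid_dvdM // (negPf bc5') !orbF.
have {e} : (j * 2 * b == j * 2 * c %[mod 5])%N.
  rewrite -(modn_dvdm (j * 2 * b) n5) -(modn_dvdm (j * 2 * c) n5).
  by rewrite mulnAC (eqP e) mulnAC.
rewrite -!(mulnA j) => e; apply: contraT => j5; case/negP: bc5.
rewrite -(eqmod_mull_prime _ _ (isT : prime 5) (isT : ~~ (5 %| 2)%N)).
by rewrite -(eqmod_mull_prime _ _ (isT : prime 5) j5).
Qed.

Lemma core_no_type2 (j : 'I_n) : ~ type2 R a b c j.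
Proof.
case/type2_expr=> e1 [e2 [h1 h2 e3 ne]].
exact: ne (root_cube_inj (zjn j) (@dvd_n 3 isT) core_not_dvd9 b3 c3 h1 h2 e3).
Qed.

End Core.

Local Close Scope ring_scope.

(** * Residues modulo 30 at a type 3 zero *)

Definition pm_mod30 (t v : nat) : bool := (t == v %[mod 30]) || (30 %| t + v).

(** Divisibility by 2, 3 and 5 is read off for the products with [k]. Each prime fails to divide
    some multiple of [k], so [k] is coprime to 30 and can be cancelled. *)
Lemma type3_residues_cofactor (k a b c va vb vc : nat) :
  (va, vb, vc) \in [:: (10, 3, 9); (5, 6, 12)] ->
  pm_mod30 (k * a) va -> pm_mod30 (k * b) vb -> pm_mod30 (k * c) vc ->
  coprime k 30 /\ type3_residues a b c.
Proof.
rewrite /pm_mod30 => hv ha hb hc.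
pose P := k * a; pose Q := k * b; pose T := k * c.
have [] : [/\ [/\ 5 %| P, ~~ (5 %| Q), ~~ (5 %| T), Q != T %[mod 5] & ~~ (5 %| Q + T)],
    [/\ ~~ (3 %| P), 3 %| Q & 3 %| T] & [/\ ~~ (2 %| P + Q), ~~ (2 %| P + T)
     & ~~ (2 %| P) || ~~ (2 %| Q)]].
  move: ha hb hc; rewrite -/P -/Q -/T.
  by move: hv; rewrite !inE => /orP[] /eqP[-> -> ->] *; split; split; lia.
rewrite /P /Q /T -!mulnDr !Euclid_dvdM // !negb_or.
move=> [+ /andP[k5 b5] /andP[_ c5] + /andP[_ bc5']] [/andP[k3 a3]].
rewrite (negPf k5) (negPf k3) /= => a5 bc5 b3 c3 [/andP[k2 ab2] /andP[_ ac2] _].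
split.
  rewrite (_ : 30 = 2 * (3 * 5)) // !coprimeMr ![coprime k _]coprime_sym.
  by rewrite !prime_coprime // k2 k3 k5.
rewrite eqmod_mull_prime // in bc5.
by split; split=> //; [rewrite -[odd _]negbK -dvdn2|rewrite -[odd _]negbK -dvdn2].
Qed.

Section Type3.

Variables (R : realType) (n : nat).
Hypothesis n_gt1 : 1 < n.

Lemma is_ratio_dvd30 (j : 'I_n) (s : 'Z_n) (v : nat) :
  is_ratio j s (v%:R / 15 : R)%R -> 30 %| n * v.
Proof.
move/(is_ratio_dvdn n_gt1) => /orP[/eqP e|].
  by rewrite /dvdn -(modn_dvdm _ (dvdn_mulr n (dvdnn 30))) -e modn_dvdm ?dvdn_mulr // modnMr.
by move/(dvdn_trans (dvdn_mulr n (dvdnn 30))); rewrite dvdn_addr // dvdn_mulr.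
Qed.

Lemma is_ratio_pm_mod30 (m k : nat) (j : 'I_n) (s : 'Z_n) (v : nat) :
  n = 30 * m -> j = k * m :> nat ->
  is_ratio j s (v%:R / 15 : R)%R -> pm_mod30 (k * s) v.
Proof.
move=> Dn Dj /(is_ratio_dvdn n_gt1).
have n_gt0 : 0 < n := ltnW n_gt1.
have e1 : 30 * (j * s) = n * (k * s) by rewrite Dj; nia.
by rewrite e1 [30 * n]mulnC -mulnDr dvdn_pmul2l // -!muln_modr eqn_pmul2l.
Qed.

Lemma is_ratio_order (j : 'I_n) (s : 'Z_n) (v : nat) :
  is_ratio j s (v%:R / 15 : R)%R -> n %| 30 * j * s.
Proof.
move/(is_ratio_dvdn n_gt1); rewrite -mulnA => /orP[/eqP e|].
  by rewrite /dvdn -(modn_dvdm _ (dvdn_mull 30 (dvdnn n))) e modn_dvdm ?dvdn_mull // modnMr.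
by move/(dvdn_trans (dvdn_mull 30 (dvdnn n))); rewrite dvdn_addl // dvdn_mulr.
Qed.

Lemma type3P (a b c : 'Z_n) (j : 'I_n) :
  <<pm3 a b c>>%g = [set: 'Z_n] -> type3 R a b c j ->
  [/\ 30 %| n, exists2 k, j = k * (n %/ 30) :> nat & coprime k 30 &
      exists a' b' c' : 'Z_n,
        perm_eq [:: a; b; c] [:: a'; b'; c'] /\ type3_residues a' b' c'].
Proof.
move=> gen [r1 [r2 [r3 [/sorted_ratios_ex[p [q [r [pu [hp hq hr]]]]]]]]] hv.
have [a' [b' [c' [va [vb [vc [hvv pu' ha hb hc]]]]]]] : exists a' b' c' va vb vc,
   [/\ (va, vb, vc) \in [:: (10, 3, 9); (5, 6, 12)],
    perm_eq [:: a; b; c] [:: a'; b'; c'], is_ratio j a' (va%:R / 15 : R)%R,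
    is_ratio j b' (vb%:R / 15 : R)%R & is_ratio j c' (vc%:R / 15 : R)%R].
  case: hv => [] [D1 D2 D3].
    (* The ratios over the denominator 15, with the one whose numerator is divisible by 5 put
       first. *)
    exists r, p, q, 10, 3, 9; split=> //.
    - exact: perm_trans pu (permEl (perm_catC [:: p; q] [:: r])).
    - by rewrite (_ : _ / _ = r3)%R // D3; field.
    - by rewrite (_ : _ / _ = r1)%R // D1; field.
    - by rewrite (_ : _ / _ = r2)%R // D2; field.
  exists p, q, r, 5, 6, 12; split=> //.
  - by rewrite (_ : _ / _ = r1)%R // D1; field.
  - by rewrite (_ : _ / _ = r2)%R // D2; field.
  - by rewrite (_ : _ / _ = r3)%R // D3; field.
have n30 : 30 %| n.
  have := is_ratio_dvd30 ha; have := is_ratio_dvd30 hb; have := is_ratio_dvd30 hc.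
  by move: hvv; rewrite !inE => /orP[] /eqP[-> -> ->]; lia.
have Dn : n = 30 * (n %/ 30) by rewrite mulnC divnK.
(* Each generator [s] satisfies [n %| 30 * j * s], hence so does 1. *)
have nj : n %| 30 * j.
  rewrite (pm3_perm pu') in gen.
  exact: generated_dvdn n_gt1 gen (is_ratio_order ha) (is_ratio_order hb) (is_ratio_order hc).
have [k Dj] : exists k, j = k * (n %/ 30) :> nat.
  by apply/dvdnP; move: nj; rewrite {1}Dn dvdn_pmul2l.
have [cop res] := type3_residues_cofactor hvv (is_ratio_pm_mod30 Dn Dj ha)
  (is_ratio_pm_mod30 Dn Dj hb) (is_ratio_pm_mod30 Dn Dj hc).
by split=> //; [exists k|exists a', b', c'].
Qed.

End Type3.

Theorem proposition6p2 (R : realType) (n : nat) (S : {set 'Z_n})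
    (a b c : 'Z_n)
    (hn : 7 <= n)
    (hS : S = pm3 a b c)
    (hcard : #|S| = 6)
    (hgen : <<S>>%g = [set: 'Z_n])
    (hdm : distance_magic (circ S))
    (h3 : exists2 j, j \in chi_zeros R S & type3 R a b c j) :
  [/\ [/\ 60 %| n, n`_3 = 3 & n`_5 = 5],
      exists s : 'Z_n,
        unique (fun s : 'Z_n => [/\ s \in S, 5 %| s & 2 * s < n]) s /\
        (12 * s = n \/ 12 * s = 5 * n),
      (exists2 j, j \in chi_zeros R S & type1 R a b c j) /\
      ~ (exists2 j, j \in chi_zeros R S & type2 R a b c j)
    & (forall j, j \in chi_zeros R S -> type1 R a b c j ->
         odd j /\ 15 %| j) /\
      (forall j, j \in chi_zeros R S -> type3 R a b c j ->
         ~~ odd j /\ coprime j 15)].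
Proof.
have n_gt1 : 1 < n by apply: leq_trans hn.
have n_gt0 := ltnW n_gt1.
rewrite hS in hcard hgen hdm h3 *.
have [j0 _ /(type3P n_gt1 hgen)[n30 _ [a' [b' [c' [pu res]]]]]] := h3.
have t1 j : type1 R a b c j <-> type1 R a' b' c' j.
  split=> -[r1 [r2 [r3 [h1 h2]]]]; exists r1, r2, r3; split=> //;
    exact/(sorted_ratios_perm _ _ _ _ pu).
have t2 j : type2 R a b c j -> type2 R a' b' c' j.
  move=> [r1 [r2 [r3 [h1 h2]]]]; exists r1, r2, r3; split=> //.
  exact/(sorted_ratios_perm _ _ _ _ pu).
have typ3 j : type3 R a b c j -> exists2 k, j = k * (n %/ 30) :> nat & coprime k 30.
  by case/(type3P n_gt1 hgen).
rewrite (pm3_perm pu) in hcard hgen hdm h3 *.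
have [[a5 b5 c5 bc5 bc5'] [a3 b3 c3] [oab oac]] := res.
have n4 : 4 %| n by apply: (core_dvd4 n_gt1 hcard hdm n30).
have n9 : ~~ (9 %| n) by apply: (core_not_dvd9 R n_gt1 hcard hdm n30 res).
have n25 : ~~ (25 %| n) by apply: (core_not_dvd25 R n_gt1 hcard hdm n30 res).
have n60 : 60 %| n by rewrite (@Gauss_dvd 4 15) // n4 (dvdn_trans _ n30).
have part1 p : prime p -> p %| n -> ~~ (p * p %| n) -> n`_p = p.
  move=> pr_p pn ppn; rewrite p_part; suff -> : logn p n = 1 by rewrite expn1.
  apply/eqP; rewrite eqn_leq -pfactor_dvdn // pn andbT.
  by rewrite leqNgt -pfactor_dvdn // -mulnn.
split.
- split=> //; first exact: (part1 3 isT (dvdn_trans (isT : 3 %| 30) n30) n9).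
  exact: (part1 5 isT (dvdn_trans (isT : 5 %| 30) n30) n25).
- have [q Dq hq] : exists2 q, 12 * a' = q * n & q \in [:: 1; 5; 7; 11].
    exact: (core_12a_cofactor R n_gt1 hcard hgen hdm n30 res).
  have valN (s : 'Z_n) : 0 < s -> (- s)%R = n - s :> nat.
    by move=> s_gt0; rewrite val_ZpN // modn_small // ltn_subrL s_gt0.
  have a_gt0 : 0 < a' by rewrite lt0n; apply: contraNneq a3 => ->.
  have b_gt0 : 0 < b' by rewrite lt0n; apply: contraNneq b5 => ->.
  have c_gt0 : 0 < c' by rewrite lt0n; apply: contraNneq c5 => ->.
  have lt_an := ltn_Zp a' n_gt1.
  have lt_bn := ltn_Zp b' n_gt1.
  have lt_cn := ltn_Zp c' n_gt1.
  (* Of [a'] and its opposite take the one below [n / 2]: it is [a'] for [q] = 1 or 5, and [n - a']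
     for [q] = 7 or 11, as [12 * (n - a') = (12 - q) * n]. *)
  have [s [sS sa s12]] : exists s : 'Z_n, [/\ s \in [:: a'; - a']%R,
      s = a' :> nat \/ s = n - a' :> nat & 12 * s = n \/ 12 * s = 5 * n].
    move: hq; rewrite !inE => /or4P[] /eqP Dq'; rewrite Dq' in Dq.
    - by exists a'; split; rewrite ?mem_head; [|left|left; lia].
    - by exists a'; split; rewrite ?mem_head; [|left|right; lia].
    - by exists (- a')%R; split; rewrite ?inE ?eqxx ?orbT ?valN //; [right|right; lia].
    by exists (- a')%R; split; rewrite ?inE ?eqxx ?orbT ?valN //; [right|left; lia].
  exists s; split=> //; split.
    split; last by lia.
      by move: sS; rewrite !inE => /orP[] /eqP ->; rewrite eqxx ?orbT.
    by lia.
  (* The elements from [b'] and [c'] are not divisible by 5, and the opposite of [s] lies above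
     [n / 2]. *)
  move=> s' [s'S s'5 s'n]; apply/val_inj => /=.
  move: s'S; rewrite !inE -!orbA.
  case/or4P=> [|||/or3P[]] /eqP Ds'; have := congr1 (@nat_of_ord _) Ds';
    rewrite ?valN //; lia.
- split; last by case=> j _ /t2; exact: (core_no_type2 n_gt1 hcard hdm n30 res).
  have [j jA tj] : exists2 j, j \in chi_zeros R (pm3 a' b' c') & type1 R a' b' c' j.
    exact: (core_type1_ex R n_gt1 hcard hdm n30 res).
  by exists j => //; apply/t1.
split=> [j _ /t1|j _ /typ3[k Dj cop]].
  exact: (core_type1 n_gt1 hcard hgen hdm n30 res).
(* As [j = k * (n / 30)], evenness comes from [4 %| n], and coprimality to 15 from 9 and 25 not
   dividing [n]. *)
have m2 : 2 %| n %/ 30 by lia.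
have cop15 : coprime (n %/ 30) 15.
  rewrite (_ : 15 = 3 * 5) // coprimeMr ![coprime (n %/ 30) _]coprime_sym !prime_coprime //.
  by apply/andP; split; lia.
rewrite Dj -dvdn2 dvdn_mull //; split=> //.
by rewrite coprimeMl cop15 andbT; apply: coprime_dvdr cop.
Qed.
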